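(* Let $n\ge 2$ and let $T=\varphi(t)\,dt^2+t^2\psi(t)\,d\Theta^2$ be a smooth, nonsingular, rotationally symmetric tensor on $\mathbb{R}^n$. Let $$\mathcal{F}(t,w,p)=\frac{1}{n-1}\left[(n-2)\varphi(t)(w^2-2w)+t^2\varphi(t)\psi(t)\right]-p^2 .$$ Suppose that $\mathcal{F}^{-1}(0)$ is a regular surface for all $t\ge 0$ (that is, $d\mathcal{F}\neq 0$ at every point $(t,w,p)$ with $t\ge0$ and $\mathcal{F}(t,w,p)=0$), and that $$\varphi(t)\,\frac{d}{dt}\left(t^2\psi(t)\right)\neq 0\quad\text{for all } t>0$$ (so that the set $\Sigma=\{(t,w,p): \mathcal{F}(t,w,p)=\mathcal{F}_p(t,w,p)=0\}$ is a regular curve). Then there exists a rotationally symmetric Riemannian metric $g$ defined on all of $\mathbb{R}^n$ such that $\mathrm{Ric}(g)=T$.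
   Context: Here $t=|x|\ge 0$ is the Euclidean distance to the origin of $\mathbb{R}^n$, $\Theta=x/|x|\in\mathbb{S}^{n-1}$, and $d\Theta^2$ is the standard metric of the unit sphere $\mathbb{S}^{n-1}$. A symmetric 2-tensor $T$ (or a metric $g$) on $\mathbb{R}^n$ is rotationally symmetric if it is invariant under pullback by every $\gamma\in SO(n)$. Nonsingular means nondegenerate at every point; such a $T$ is either positive or negative definite everywhere, and $\varphi(0)=\psi(0)$. $\mathcal{F}_p$ denotes $\partial\mathcal{F}/\partial p$. The functions $\varphi,\psi$ are smooth on $[0,\infty)$, and derivatives at $t=0$ may be taken one-sided (or after a smooth extension to $t<0$). $\mathrm{Ric}(g)$ denotes the Ricci tensor of $g$ (with the convention that it is positive on round spheres). *)

(* Defs.v *)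
From HB Require Import structures.
From mathcomp Require Import all_boot all_order all_algebra.
From mathcomp Require Import all_classical all_reals all_analysis.

Set Implicit Arguments.
Unset Strict Implicit.
Unset Printing Implicit Defensive.

Import Order.TTheory GRing.Theory Num.Theory.
Import numFieldNormedType.Exports.

Local Open Scope classical_set_scope.
Local Open Scope ring_scope.

(* Points and tangent vectors of R^n
   are row vectors; a 2-tensor field T is given by its matrix in the standard
   coordinates, T_x(u, v) = u *m T x *m v^T. *)
Definition tensor2 (R : realType) (n : nat) := 'rV[R]_n -> 'M[R]_n.

Section Coordinates.
Context {R : realType} {n : nat}.
Implicit Types (f : 'rV[R]_n -> R) (T g : tensor2 R n) (x : 'rV[R]_n).

Definition pderiv (i : 'I_n) f x : R := 'D_(delta_mx 0 i) f x.

Fixpoint class_C (k : nat) f : Prop :=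
  match k with
  | 0 => continuous f
  | k'.+1 => continuous f /\
      forall i : 'I_n, (forall x, derivable f x (delta_mx 0 i)) /\
                       class_C k' (pderiv i f)
  end.

Definition smooth f : Prop := forall k, class_C k f.

Definition smooth_tensor T : Prop := forall i j, smooth (fun x => T x i j).

Definition symmetric_tensor T : Prop := forall x, (T x)^T = T x.

Definition nonsingular T : Prop := forall x, T x \in unitmx.

(* The pullback of T by the linear map x |-> x *m A. *)
Definition pullback (A : 'M[R]_n) T : tensor2 R n :=
  fun x => A *m T (x *m A) *m A^T.

Definition special_orthogonal (A : 'M[R]_n) : Prop :=
  A *m A^T = 1%:M /\ \det A = 1.

Definition rotationally_symmetric T : Prop :=
  forall A, special_orthogonal A -> forall x, pullback A T x = T x.

(* The library norm on 'rV[R]_n is the sup norm, hence an explicit one. *)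
Definition enorm x : R := Num.sqrt (\sum_(i < n) x 0 i ^+ 2).

Definition sphere_proj (k : 'I_n) x : R := x 0 k / enorm x.

Definition dt2 : tensor2 R n :=
  fun x => \matrix_(i, j) (pderiv i enorm x * pderiv j enorm x).

(* The pullback under x |-> x / |x| of the metric induced on the unit sphere
   by the Euclidean metric of R^n; like dt2, meaningful for x != 0. *)
Definition dTheta2 : tensor2 R n :=
  fun x => \matrix_(i, j)
    \sum_(k < n) pderiv i (sphere_proj k) x * pderiv j (sphere_proj k) x.

Definition riemannian_metric g : Prop :=
  [/\ smooth_tensor g, symmetric_tensor g
    & forall x (v : 'rV[R]_n), v != 0 -> 0 < (v *m g x *m v^T) 0 0].

(* christoffel g k i j is Gamma^k_{ij}. *)
Definition christoffel g (k i j : 'I_n) x : R :=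
  2^-1 * \sum_(l < n) invmx (g x) k l *
    (pderiv i (fun y => g y j l) x + pderiv j (fun y => g y i l) x
     - pderiv l (fun y => g y i j) x).

(* riemann g l k i j is R^l_{kij}, where
   R(d_i, d_j) d_k = \sum_l R^l_{kij} d_l and
   R(X, Y) = [nabla_X, nabla_Y] - nabla_[X, Y]. *)
Definition riemann g (l k i j : 'I_n) x : R :=
  pderiv i (christoffel g l j k) x - pderiv j (christoffel g l i k) x
  + \sum_(m < n) (christoffel g l i m x * christoffel g m j k x
                  - christoffel g l j m x * christoffel g m i k x).

(* Ric(Y, Z) = tr (X |-> R(X, Y) Z), positive on round spheres. *)
Definition ricci g : tensor2 R n :=
  fun x => \matrix_(i, j) \sum_(k < n) riemann g k j k i x.

End Coordinates.

(* A smooth function on [0, +oo) is represented by a smooth extension to R;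
   everything below uses only its values and derivatives at t >= 0. *)
Definition smooth1 {R : realType} (f : R -> R) : Prop :=
  forall (k : nat) (t : R), derivable (derive1n k f) t 1.

Definition calF {R : realType} (n : nat) (phi psi : R -> R)
    (q : R * R * R) : R :=
  let: (t, w, p) := q in
  (n.-1)%:R^-1 * ((n.-2)%:R * phi t * (w ^+ 2 - 2 * w)
                  + t ^+ 2 * phi t * psi t) - p ^+ 2.

(* Main.v *)
(* Write [g = a^2 dt^2 + b^2 dTheta^2], [e = 1] or [-1] for the sign of [phi],
   [S = sqrt (e phi / (n-1))], and let [c = b'/a = 1 - w] be the derivative of
   the warping function with respect to arclength.  Then [Ric(g) = T] amounts to
   [c' = - e t S u] together with
     [t^2 u^2 = t^2 |psi| - e (n-2) (1 - c^2)],   [u = b S / (a t)],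
   which is the equation [F(t, w, w') = 0].  Differentiating the second relation
   removes the square root: with [2 t beta = (t^2 |psi|)' > 0],
     [t u' + u = beta / u - (n-2) S c],   [c(0) = 1],   [u(0) = S(0)].
   Since [beta > 0], an explicit barrier keeps [u] away from 0, so that clamping
   [u] from below and [c] from above makes the system Lipschitz; it is solved on
   all of [0, +oo) at once by Picard iteration for the operator that sends [X] to
   the bounded solution of [t v' + (m+1) v = X].

   Smoothness at the origin: an even function [f] gives a smooth function [f(|x|)]
   as soon as the operator [D f = f'/t] can be iterated.  Each [D^k u] solves a
   linear singular equation [t v' + m v = A + B v] with [B(0) = 0], whose bounded
   solutions are continuous at 0.  The metric is
   [exp(2f) (lam^2 dt^2 + t^2 dTheta^2)] with [lam = S/u], [D f = (c lam - 1)/t^2]. *)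
Require Import Defs.
From HB Require Import structures.
From mathcomp Require Import all_boot all_order all_algebra.
From mathcomp Require Import all_classical all_reals all_analysis.
From mathcomp Require Import ring lra.
Import Order.TTheory GRing.Theory Num.Theory.
Import numFieldNormedType.Exports.
Set Implicit Arguments.
Unset Strict Implicit.
Unset Printing Implicit Defensive.
Local Open Scope classical_set_scope.
Local Open Scope ring_scope.

(** Solving [F = 0] for [w'] produces a square root that is not Lipschitz where it vanishes, that is
    on Sigma, and the starting point [t = w = p = 0] lies on Sigma. Differentiating trades the root
    for the term [beta / u], at the price of a constant of integration: [c(0) = 1] makes that
    constant 0, and [phi(0) = psi(0)] selects [u(0) = S(0)]. The lower bound for [u] needs an upper
    bound for [c], while for [e = -1] the upper bound for [c] needs one for [u]. The circle is
    broken by the order in which the clamps are removed: the barrier for [u] already holds with [c]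
    clamped, and only afterwards is the clamp on [c] shown to be inactive. All functions of [t] are
    even functions on the whole line, so that 0 is an interior point. *)

(** * One-variable calculus *)

Section Calculus.
Context {R : realType}.
Implicit Types (f g u v : R -> R) (t a b : R).

(* Eta-expanded forms of the library rules: the instances for [f + g], [f * g] do
   not unify with [fun s => f s + g s]. *)
Lemma is_deriveDf f g t a b :
  is_derive t 1 f a -> is_derive t 1 g b ->
  is_derive t 1 (fun s => f s + g s) (a + b).
Proof. by move=> ? ?; exact: is_deriveD. Qed.

Lemma is_deriveNf f t a :
  is_derive t 1 f a -> is_derive t 1 (fun s => - f s) (- a).
Proof. by move=> ?; exact: is_deriveN. Qed.

Lemma is_deriveBf f g t a b :
  is_derive t 1 f a -> is_derive t 1 g b ->
  is_derive t 1 (fun s => f s - g s) (a - b).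
Proof. by move=> ? ?; exact: is_deriveB. Qed.

Lemma is_deriveMf f g t a b :
  is_derive t 1 f a -> is_derive t 1 g b ->
  is_derive t 1 (fun s => f s * g s) (a * g t + f t * b).
Proof.
move=> ? ?; apply: (@is_derive_eq _ _ _ (f * g)).
by rewrite addrC [g t *: a]mulrC.
Qed.

Lemma is_deriveCf c t : is_derive t 1 (fun _ : R => c : R) 0.
Proof. exact: is_derive_cst. Qed.

Lemma is_deriveIf t : is_derive t 1 (fun s : R => s) 1.
Proof. exact: is_derive_id. Qed.

Lemma is_deriveXf f n t a : is_derive t 1 f a ->
  is_derive t 1 (fun s => f s ^+ n) (n%:R * f t ^+ n.-1 * a).
Proof. by move=> fa; have := is_deriveX n fa; rewrite exprfctE. Qed.

Lemma is_deriveVf f t a : f t != 0 ->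
  is_derive t 1 f a -> is_derive t 1 (fun s => (f s)^-1) (- a / f t ^+ 2).
Proof.
move=> f0 [fa <-]; apply: DeriveDef; first exact: derivableV.
by rewrite deriveV// [_ *: _]mulrC mulrN mulNr.
Qed.

Lemma is_derive_compf f g t a b :
  is_derive (g t) 1 f a -> is_derive t 1 g b ->
  is_derive t 1 (fun s => f (g s)) (a * b).
Proof. by move=> ? ?; exact: is_derive1_comp. Qed.

Lemma is_derive_sqrtf f t a : 0 < f t -> is_derive t 1 f a ->
  is_derive t 1 (fun s => Num.sqrt (f s)) (a / (2 * Num.sqrt (f t))).
Proof.
move=> f0 fa; have := is_derive_compf (is_derive1_sqrt f0) fa.
by rewrite mulrC.
Qed.

Lemma is_derive_continuous f t a : is_derive t 1 f a -> {for t, continuous f}.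
Proof.
by move=> [fa _]; apply/differentiable_continuous; rewrite -derivable1_diffP.
Qed.

Lemma is_derive_unique f t a b :
  is_derive t 1 f a -> is_derive t 1 f b -> a = b.
Proof. by move=> [_ <-] [_ <-]. Qed.

Lemma is_derive_near f g t a :
  (\near t, f t = g t) -> is_derive t 1 f a -> is_derive t 1 g a.
Proof. by move=> H; apply: near_eq_is_derive. Qed.

Lemma MVT_seg f f' a b : a < b ->
  (forall x, a <= x <= b -> {for x, continuous f}) ->
  (forall x, a < x < b -> is_derive x 1 f (f' x)) ->
  exists2 c, a < c < b & f b - f a = f' c * (b - a).
Proof.
move=> ab fc fd.
have fd' x : x \in `]a, b[ -> is_derive x 1 f (f' x).
  by rewrite in_itv/=; exact: fd.
have fc' : {within `[a, b], continuous f}.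
  by apply: continuous_in_subspaceT => x; rewrite inE/= in_itv/=; exact: fc.
have [c cab ->] := MVT ab fd' fc'.
by exists c => //; move: cab; rewrite in_itv.
Qed.

Lemma ge0_derive_le f f' a b : a <= b ->
  (forall x, a <= x <= b -> {for x, continuous f}) ->
  (forall x, a < x < b -> is_derive x 1 f (f' x)) ->
  (forall x, a < x < b -> 0 <= f' x) -> f a <= f b.
Proof.
rewrite le_eqVlt => /predU1P[-> //|ab] fc fd f0.
have [c cab E] := MVT_seg ab fc fd.
by rewrite -subr_ge0 E mulr_ge0 ?f0// subr_ge0 ltW.
Qed.

Lemma derive_eq0_cst f a b : a <= b ->
  (forall x, a <= x <= b -> is_derive x 1 f 0) -> f a = f b.
Proof.
rewrite le_eqVlt => /predU1P[-> //|ab] fd.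
have [|x /andP[/ltW ? /ltW ?]|c cab E] := @MVT_seg f (fun=> 0) _ _ ab.
- by move=> x /fd; exact: is_derive_continuous.
- by apply: fd; apply/andP.
- by move/eqP: E; rewrite mul0r subr_eq0 => /eqP.
Qed.

Lemma continuousDf f g : continuous f -> continuous g ->
  continuous (fun s => f s + g s).
Proof. by move=> fc gc t; apply: cvgD; [exact: fc|exact: gc]. Qed.

Lemma continuousNf f : continuous f -> continuous (fun s => - f s).
Proof. by move=> fc t; apply: cvgN; exact: fc. Qed.

Lemma continuousMf f g : continuous f -> continuous g ->
  continuous (fun s => f s * g s).
Proof. by move=> fc gc t; apply: cvgM; [exact: fc|exact: gc]. Qed.

Lemma continuousCf (c : R) : continuous (fun _ : R => c).
Proof. by move=> t; exact: cvg_cst. Qed.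

Lemma continuousIf : continuous (fun s : R => s).
Proof. by move=> t; exact: cvg_id. Qed.

Lemma continuousXf n : continuous (fun s : R => s ^+ n).
Proof. exact: exprn_continuous. Qed.

Lemma continuousVf f : (forall t, f t != 0) -> continuous f ->
  continuous (fun s => (f s)^-1).
Proof. by move=> f0 fc t; apply: cvgV => //; exact: fc. Qed.

Lemma continuous_compf f g : continuous f -> continuous g ->
  continuous (fun s => f (g s)).
Proof. by move=> fc gc t; apply: continuous_comp; [exact: gc|exact: fc]. Qed.

Lemma continuous_normf f : continuous f -> continuous (fun s => `|f s|).
Proof. by move=> fc t; apply: cvg_norm; exact: fc. Qed.

Lemma continuous_maxf f g : continuous f -> continuous g ->
  continuous (fun s => Num.max (f s) (g s)).
Proof. by move=> fc gc t; apply: continuous_max; [exact: fc|exact: gc]. Qed.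

Lemma continuous_minf f g : continuous f -> continuous g ->
  continuous (fun s => Num.min (f s) (g s)).
Proof. by move=> fc gc t; apply: continuous_min; [exact: fc|exact: gc]. Qed.

Lemma continuous_sqrtf f : continuous f -> continuous (fun s => Num.sqrt (f s)).
Proof. by move=> fc; apply: continuous_compf => //; exact: sqrt_continuous. Qed.

Lemma derivable_continuous f f' : (forall t, is_derive t 1 f (f' t)) ->
  continuous f.
Proof. by move=> fd t; exact: is_derive_continuous (fd t). Qed.

Lemma continuous_epsdelta f t : {for t, continuous f} <->
  forall e, 0 < e -> exists2 d, 0 < d & forall x, `|x - t| < d -> `|f x - f t| < e.
Proof.
split.
  move=> /cvgrPdist_lt fc e e0; have /nbhs_ballP[d /= d0 db] := fc _ e0.
  exists d => // x xd; rewrite distrC; apply: db.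
  by rewrite /ball/= distrC.
move=> H; apply/cvgrPdist_lt => e e0; have [d d0 db] := H _ e0.
apply/nbhs_ballP; exists d => //= x xd; rewrite distrC; apply: db.
by rewrite distrC.
Qed.

(** By the mean value theorem each difference quotient at [t] is a value of [g] at a nearby point,
    so continuity of [g] gives the limit. This supplies derivatives at 0 of functions defined
    through a division by [t]. *)
Lemma is_derive_punctured f g t : (forall s, {for s, continuous f}) ->
  (forall s, s != t -> is_derive s 1 f (g s)) ->
  {for t, continuous g} -> is_derive t 1 f (g t).
Proof.
move=> fc fd /continuous_epsdelta gc.
suff H : h^-1 *: ((f \o shift t) (h *: 1) - f t) @[h --> 0^'] --> g t.
  by apply: DeriveDef; [apply/cvg_ex; exists (g t)|exact: cvg_lim H].
apply/cvgrPdist_lt => e e0; have [d d0 db] := gc _ e0.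
exists d => //= h; rewrite /ball/= sub0r normrN => hd h0.
rewrite /shift/= [h%:A]mulr1.
have key c : `|c - t| < d -> f (h + t) - f t = g c * h ->
    `|g t - h^-1 *: (f (h + t) - f t)| < e.
  move=> cd ->; rewrite [_ *: _]mulrCA mulVf// mulr1 distrC; exact: db.
have [hlt|hgt|h00] := ltgtP h 0; last by rewrite h00 eqxx in h0.
- have [|||c /andP[c1 c2] E] := @MVT_seg f g (h + t) t; first by lra.
  + by move=> *; exact: fc.
  + by move=> x /andP[_ xt]; apply: fd; rewrite lt_eqF.
  + apply: (key c); last by lra.
    by rewrite ltr_norml; move: hd; rewrite ltr_norml; lra.
- have [|||c /andP[c1 c2] E] := @MVT_seg f g t (h + t); first by lra.
  + by move=> *; exact: fc.
  + by move=> x /andP[xt _]; apply: fd; rewrite gt_eqF.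
  + apply: (key c); last by rewrite E; ring.
    by rewrite ltr_norml; move: hd; rewrite ltr_norml; lra.
Qed.

End Calculus.

(** * Averages with a power weight *)

Section Antiderivative.
Context {R : realType}.
Implicit Types (f g u v : R -> R) (s t a b x : R).

Lemma antiderivative_from f a : continuous f ->
  exists F : R -> R, forall t, a < t -> is_derive t 1 F (f t).
Proof.
move=> fc; exists (fun x => \int[@lebesgue_measure R]_(t in `[a, x]) f t)%R.
move=> t at_.
have intf : (@lebesgue_measure R).-integrable `[a, t + 1] (EFin \o f).
  apply: continuous_compact_integrable; first exact: segment_compact.
  exact: continuous_subspaceT.
have [|||H1 H2] := @continuous_FTC1_closed R f a t (t + 1) _ intf => //.
- by rewrite ltrDl.
- exact: fc.
- by apply: DeriveDef; [exact: H1|rewrite -derive1E].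
Qed.

(** An integral from a base point is differentiated only to the right of that point, so the base
    point [- (|x| + 1)] moves with [x]. Subtracting the value at 0 makes different base points
    agree; this is [glue]. *)
Lemma antiderivative f : continuous f ->
  exists2 F : R -> R, F 0 = 0 & forall t, is_derive t 1 F (f t).
Proof.
move=> fc; have [G Gd] := choice (fun a => antiderivative_from a fc).
have glue b c x : b <= c -> b < 0 -> b < x -> c < 0 -> c < x ->
    G b x - G b 0 = G c x - G c 0.
  move=> bc b0 bx c0 cx.
  have H y z : c < y -> y <= z -> G b y - G c y = G b z - G c z.
    move=> cy yz; apply: (@derive_eq0_cst _ (fun w => G b w - G c w)) => // w /andP[yw _].
    rewrite -[0](subrr (f w)); apply: is_deriveBf; apply: Gd; lra.
  have [x0|x0] := leP x 0.
    have := H x 0 cx x0; lra.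
  have := H 0 x c0 (ltW x0); lra.
pose F x := G (- (`|x| + 1)) x - G (- (`|x| + 1)) 0.
exists F; first by rewrite /F subrr.
move=> t.
(* For [|x - t| <= 1] the fixed base [- (|t| + 2)] lies to the left of every moving base point, so
   near [t] this function coincides with [F]. *)
have H : is_derive t 1 (fun x => G (- (`|t| + 2)) x - G (- (`|t| + 2)) 0) (f t).
  rewrite -[f t]subr0; apply: is_deriveBf.
  by apply: Gd; have := ler_norm (- t); rewrite normrN; lra.
apply: is_derive_near H.
near=> x; apply: glue.
- suff : `|x| <= `|t| + 1 by lra.
  have : `|x - t| <= 1.
    by near: x; have := @cvg_id _ (nbhs t) => /cvgrPdist_le /(_ 1 ltr01); apply: filterS => y; rewrite distrC.
  have := ler_normD (x - t) t; rewrite subrK; lra.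
- have := normr_ge0 t; lra.
- have : `|x - t| <= 1.
    by near: x; have := @cvg_id _ (nbhs t) => /cvgrPdist_le /(_ 1 ltr01); apply: filterS => y; rewrite distrC.
  rewrite ler_norml; have := ler_norm (- t); rewrite normrN; lra.
- have := normr_ge0 x; lra.
- have := ler_norm (- x); rewrite normrN; lra.
Unshelve. all: by end_near. Qed.

(** The choice makes this a total operator, usable without a continuity proof as argument; the
    default is the zero function. *)
Definition primitive f : R -> R :=
  xget (fun=> 0) [set F | F 0 = 0 /\ forall t, is_derive t 1 F (f t)].

Lemma primitiveP f : continuous f ->
  primitive f 0 = 0 /\ forall t, is_derive t 1 (primitive f) (f t).
Proof.
move=> /antiderivative[F F0 Fd].
by apply: (@xgetPex _ _ [set F | F 0 = 0 /\ forall t, is_derive t 1 F (f t)]); exists F.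
Qed.

Lemma primitive0 f : continuous f -> primitive f 0 = 0.
Proof. by case/primitiveP. Qed.

Lemma is_derive_primitive f t : continuous f ->
  is_derive t 1 (primitive f) (f t).
Proof. by case/primitiveP => _; exact. Qed.

Lemma is_derive_inj f g h : f 0 = g 0 ->
  (forall t, is_derive t 1 f (h t)) -> (forall t, is_derive t 1 g (h t)) ->
  f =1 g.
Proof.
move=> fg fd gd t.
have H a b : a <= b -> f a - g a = f b - g b.
  move=> ab; apply: (@derive_eq0_cst _ (fun w => f w - g w)) => // w _.
  rewrite -[0](subrr (h w)); exact: is_deriveBf.
by have [/H|/ltW/H] := leP 0 t; rewrite fg; lra.
Qed.

Lemma primitive_unique f F : continuous f -> F 0 = 0 ->
  (forall t, is_derive t 1 F (f t)) -> primitive f =1 F.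
Proof.
move=> fc F0 Fd; apply: (@is_derive_inj _ _ f); first by rewrite primitive0.
by move=> t; exact: is_derive_primitive.
Qed.

Lemma is_derive_opp f t a : is_derive (- t) 1 f a ->
  is_derive t 1 (fun s => f (- s)) (- a).
Proof.
by move=> fa; rewrite -mulrN1; apply: is_derive_compf => //; exact: is_deriveNf.
Qed.

(* [avg m u t] is [t^-(m+1) \int_0^t s^m u(s) ds], extended by continuity at 0:
   the solution regular at 0 of [t v' + (m+1) v = u]. *)
Definition avg m u t :=
  if t == 0 then u 0 / m.+1%:R
  else primitive (fun s : R => s ^+ m * u s) t / t ^+ m.+1.

Lemma avg_integrand m u : continuous u -> continuous (fun s : R => s ^+ m * u s).
Proof. by move=> uc; apply: continuousMf => //; exact: continuousXf. Qed.

(** Cauchy's mean value theorem for the primitive and [s^(m+1)], with [h] as auxiliary function. The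
    intermediate point is nonzero, so [c^m] cancels; [|c| <= |t|] yields continuity of [avg m u] at
    0. *)
Lemma avg_mean m u t : continuous u ->
  exists2 c, `|c| <= `|t| & avg m u t = u c / m.+1%:R.
Proof.
move=> uc; rewrite /avg; have [->|t0] := eqVneq t 0; first by exists 0.
have [A0 Ad] := primitiveP (avg_integrand (m:=m) uc).
move: A0 Ad; set A := primitive _ => A0 Ad.
pose h s := A s * t ^+ m.+1 - A t * s ^+ m.+1.
pose h' s := s ^+ m * u s * t ^+ m.+1 - A t * (m.+1%:R * s ^+ m).
have hd s : is_derive s 1 h (h' s).
  have -> : h' s = (s ^+ m * u s * t ^+ m.+1 + A s * 0)
     - (0 * s ^+ m.+1 + A t * (m.+1%:R * s ^+ m * 1)) by rewrite /h'; ring.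
  apply: is_deriveBf; apply: is_deriveMf => //; try exact: is_deriveCf.
  by apply: is_deriveXf; exact: is_deriveIf.
have h0 : h 0 = 0 by rewrite /h A0 expr0n /= mul0r mulr0 subrr.
have ht : h t = 0 by rewrite /h subrr.
have [c [ct c0] hc] : exists2 c, `|c| <= `|t| /\ c != 0 & h' c = 0.
  have hc s : {for s, continuous h} by exact: is_derive_continuous (hd s).
  case: (ltgtP t 0) => [tn|tp|]; last by move/eqP; rewrite (negPf t0).
  - have [c /andP[c1 c2]] := MVT_seg tn (fun x _ => hc x) (fun x _ => hd x).
    rewrite h0 ht subrr => /esym/eqP; rewrite mulf_eq0 sub0r oppr_eq0 (negPf t0) orbF => /eqP H.
    exists c => //; split; last by rewrite lt_eqF.
    by rewrite !ltr0_norm// lerN2 ltW.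
  - have [c /andP[c1 c2]] := MVT_seg tp (fun x _ => hc x) (fun x _ => hd x).
    rewrite h0 ht subrr => /esym/eqP; rewrite mulf_eq0 subr0 (negPf t0) orbF => /eqP H.
    exists c => //; split; last by rewrite gt_eqF.
    by rewrite !gtr0_norm// ltW.
exists c => //.
have cm : c ^+ m != 0 by rewrite expf_neq0.
have tm : t ^+ m.+1 != 0 by rewrite expf_neq0.
have m0 : m.+1%:R != 0 :> R by rewrite pnatr_eq0.
apply/eqP; rewrite eqr_div//; apply/eqP; apply: (mulfI cm).
by move/eqP: hc; rewrite subr_eq0 => /eqP hc; rewrite [RHS]mulrA hc; ring.
Qed.

Lemma avg0 m u : avg m u 0 = u 0 / m.+1%:R.
Proof. by rewrite /avg eqxx. Qed.

Lemma avg_solves m u t : continuous u -> t != 0 ->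
  is_derive t 1 (avg m u) ((u t - m.+1%:R * avg m u t) / t).
Proof.
move=> uc t0; rewrite {2}/avg (negPf t0).
set A := primitive _.
have H : is_derive t 1 (fun s => A s * (s ^+ m.+1)^-1)
    ((u t - m.+1%:R * (A t / t ^+ m.+1)) / t).
  apply: is_derive_eq.
    apply: is_deriveMf; first exact/is_derive_primitive/avg_integrand.
    apply: is_deriveVf; first by rewrite expf_neq0.
    by apply: is_deriveXf; exact: is_deriveIf.
  by rewrite /= !exprS; field; rewrite t0 expf_neq0.
apply: is_derive_near H.
have : \forall s \near t, s != 0.
  by apply: open_neq.
by apply: filterS => s s0; rewrite /avg (negPf s0).
Qed.

Lemma continuous_avg m u : continuous u -> continuous (avg m u).
Proof.
move=> uc t; have [->|t0] := eqVneq t 0; last first.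
  by apply: is_derive_continuous; exact: avg_solves.
apply/continuous_epsdelta => e e0.
have /continuous_epsdelta/(_ _ e0)[d d0 ud] := uc 0.
exists d => // x; rewrite subr0 => xd.
have [c cx ->] := avg_mean m x uc.
rewrite avg0 -mulrBl normrM.
rewrite (le_lt_trans _ (ud c _))//; last by rewrite subr0 (le_lt_trans cx).
rewrite ler_piMr// normfV normr_nat invf_le1 ?ltr0n// ler1n//.
Qed.

Lemma avg_even m u : continuous u -> (forall t, u (- t) = u t) ->
  forall t, avg m u (- t) = avg m u t.
Proof.
move=> uc ue t; rewrite /avg oppr_eq0; case: ifP => // /negbT t0.
have vc := avg_integrand (m := m) uc.
pose F s := (-1) ^+ m.+1 * primitive (fun s : R => s ^+ m * u s) (- s).
have F0 : F 0 = 0 by rewrite /F oppr0 primitive0// mulr0.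
have Fd s : is_derive s 1 F (s ^+ m * u s).
  apply: is_derive_eq.
    by apply: is_deriveMf; apply: is_derive_opp; exact: is_derive_primitive.
  rewrite mul0r add0r ue [X in - (X * _)]exprNn exprS.
  have H : (-1) ^+ m * (-1) ^+ m = 1 :> R by rewrite -expr2 sqrr_sign.
  transitivity ((-1) ^+ m * (-1) ^+ m * (s ^+ m * u s)); last by rewrite H mul1r.
  ring.
rewrite (primitive_unique vc F0 Fd t) /F [in LHS]exprNn invfM.
by rewrite invr_sign; ring.
Qed.

(** Integration by parts. By [avg_solves] the left side is [t] times the derivative of [avg m u], so
    dividing by [t] gives a formula for that derivative that stays continuous at 0. *)
Lemma avg_parts m u u' t : continuous u' -> (forall t, is_derive t 1 u (u' t)) ->
  u t - m.+1%:R * avg m u t = t * avg m.+1 u' t.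
Proof.
move=> uc' ud; have uc := derivable_continuous ud.
have [->|t0] := eqVneq t 0.
  by rewrite avg0 mul0r mulrC divfK ?subrr// pnatr_eq0.
rewrite /avg (negPf t0).
pose F s := s ^+ m.+1 * u s - m.+1%:R * primitive (fun s : R => s ^+ m * u s) s.
have vc := avg_integrand (m := m) uc.
have F0 : F 0 = 0 by rewrite /F exprS primitive0// !mul0r mulr0 subrr.
have Fd s : is_derive s 1 F (s ^+ m.+1 * u' s).
  apply: is_derive_eq.
    apply: is_deriveBf; apply: is_deriveMf.
      by apply: is_deriveXf; exact: is_deriveIf.
    exact: is_derive_primitive.
  by rewrite /=; ring.
rewrite (primitive_unique (avg_integrand uc') F0 Fd t) /F.
by rewrite !exprS; field; rewrite t0 expf_neq0.
Qed.

Lemma is_derive_avg m u u' : continuous u' -> (forall t, is_derive t 1 u (u' t)) ->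
  forall t, is_derive t 1 (avg m u) (avg m.+1 u' t).
Proof.
move=> uc' ud t; have uc := derivable_continuous ud.
have H s : s != 0 -> is_derive s 1 (avg m u) (avg m.+1 u' s).
  move=> s0; have := avg_solves m uc s0.
  by rewrite (avg_parts _ _ uc' ud) mulrC mulKf.
have [->|/H//] := eqVneq t 0.
apply: is_derive_punctured => //; first exact: continuous_avg.
exact: continuous_avg.
Qed.

End Antiderivative.

(** * Even functions smooth in the square of the variable *)

Section RadialClass.
Context {R : realType}.
Implicit Types (f g u v : R -> R) (s t a b x c : R) (k m : nat).

(* [f] is even and the operator [f |-> f'(t) / t] can be applied [k] times to it
   with continuous results: [f(t) = h(t^2)] with [h] of class C^k on [0, +oo). *)
Fixpoint rad k f : Prop :=
  (forall t, f (- t) = f t) /\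
  match k with
  | 0 => continuous f
  | k'.+1 => exists2 g, (forall t, is_derive t 1 f (t * g t)) & rad k' g
  end.

Lemma rad_even k f t : rad k f -> f (- t) = f t.
Proof. by case: k => [|k] [->]. Qed.

Lemma rad_continuous k f : rad k f -> continuous f.
Proof.
by case: k => [|k] [_ ] // [g fd _] t; exact: is_derive_continuous (fd t).
Qed.

Lemma radW k f : rad k.+1 f -> rad k f.
Proof.
elim: k f => [|k IH] f [fe [g fd gk]]; split=> //.
  by move=> t; exact: is_derive_continuous (fd t).
by exists g => //; exact: IH.
Qed.

(** Carries to 0 the identities that are proved by dividing by [t]. *)
Lemma punctured_eq f g : continuous f -> continuous g ->
  (forall t, t != 0 -> f t = g t) -> f = g.
Proof.
move=> fc gc fg; apply/funext => t; have [->|/fg//] := eqVneq t 0.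
apply/eqP; rewrite -subr_eq0 -normr_eq0; apply/negPn/negP => n0.
pose e := `|f 0 - g 0| / 2.
have e0 : 0 < e by rewrite divr_gt0// lt_def n0 normr_ge0.
have /continuous_epsdelta/(_ _ e0)[d d0 fd] := fc 0.
have /continuous_epsdelta/(_ _ e0)[d' d'0 gd] := gc 0.
pose x := Num.min d d' / 2.
have x0 : 0 < x by rewrite divr_gt0// lt_min d0.
have xd : `|x - 0| < d.
  by rewrite subr0 gtr0_norm// ltr_pdivrMr// mulr2n mulrDr mulr1 gt_min ltrDl d0.
have xd' : `|x - 0| < d'.
  rewrite subr0 gtr0_norm// /x; have : Num.min d d' <= d' by rewrite ge_min lexx orbT.
  by move: d'0; lra.
have := fd _ xd; have := gd _ xd'; rewrite fg ?gt_eqF// => H1 H2.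
have := ler_normB (g x - g 0) (g x - f 0).
rewrite (_ : _ - _ - _ = f 0 - g 0); last by ring.
by move: H1 H2; rewrite /e; lra.
Qed.

(** The witness hidden in [rad k.+1 f] could depend on [k]; continuity determines it, so a single
    quotient serves every order. *)
Lemma radD1 k f g : rad k.+1 f -> (forall t, is_derive t 1 f (t * g t)) ->
  continuous g -> rad k g.
Proof.
move=> [fe [h fd hk]] gd gc; suff -> : g = h by [].
apply: punctured_eq => //; first exact: rad_continuous hk.
move=> t t0; apply: (mulfI t0); exact: is_derive_unique (gd t) (fd t).
Qed.

Lemma rad_cst k (c : R) : rad k (fun=> c).
Proof.
elim: k c => [|k IH] c; split=> //; first exact: continuousCf.
exists (fun=> 0); last exact: IH.
by move=> t; rewrite mulr0; exact: is_deriveCf.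
Qed.

Lemma radD k f g : rad k f -> rad k g -> rad k (fun t => f t + g t).
Proof.
elim: k f g => [|k IH] f g [fe fk] [ge gk]; split;
  try by move=> t; rewrite fe ge.
  exact: continuousDf.
move: fk gk => [f' fd f'k] [g' gd g'k].
exists (fun t => f' t + g' t); last exact: IH.
move=> t; rewrite mulrDr; exact: is_deriveDf.
Qed.

Lemma radM k f g : rad k f -> rad k g -> rad k (fun t => f t * g t).
Proof.
elim: k f g => [|k IH] f g [fe fk] [ge gk]; split;
  try by move=> t; rewrite fe ge.
  exact: continuousMf.
move: (fk) (gk) => [f' fd f'k] [g' gd g'k].
exists (fun t => f' t * g t + f t * g' t); last first.
  by apply: radD; apply: IH => //; apply: radW.
move=> t; have := is_deriveMf (fd t) (gd t).
by congr (is_derive t 1 _ _); ring.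
Qed.

Lemma radN k f : rad k f -> rad k (fun t => - f t).
Proof.
by move=> /(radM (rad_cst k (- 1))); under eq_fun do rewrite mulN1r.
Qed.

Lemma radB k f g : rad k f -> rad k g -> rad k (fun t => f t - g t).
Proof. by move=> fk /radN; exact: radD. Qed.

Lemma rad_sqr k : rad k (fun t => t ^+ 2).
Proof.
case: k => [|k]; split; try by move=> t; rewrite sqrrN.
  exact: continuousXf.
exists (fun=> 2); last exact: rad_cst.
move=> t; have := is_deriveXf 2 (is_deriveIf t).
by congr (is_derive t 1 _ _); rewrite /=; ring.
Qed.

Lemma radX k f n : rad k f -> rad k (fun t => f t ^+ n).
Proof.
move=> fk; elim: n => [|n IH]; first by under eq_fun do rewrite expr0; exact: rad_cst.
by under eq_fun do rewrite exprS; exact: radM.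
Qed.

Lemma radV k f : (forall t, f t != 0) -> rad k f -> rad k (fun t => (f t)^-1).
Proof.
move=> f0; elim: k => [|k IH] /[dup] fk [fe fk']; split;
  try by move=> t; rewrite fe.
  exact: continuousVf.
move: fk' => [f' fd f'k].
exists (fun t => - f' t * (f t)^-1 * (f t)^-1).
  move=> t; have := is_deriveVf (f0 t) (fd t).
  by congr (is_derive t 1 _ _); rewrite expr2 invfM; ring.
have fi : rad k (fun t => (f t)^-1) by apply/IH/radW.
by do 2 apply: radM => //; apply: radN.
Qed.

Lemma rad_sqrt k f : (forall t, 0 < f t) -> rad k f ->
  rad k (fun t => Num.sqrt (f t)).
Proof.
move=> f0; elim: k => [|k IH] /[dup] fk [fe fk']; split;
  try by move=> t; rewrite fe.
  exact: continuous_sqrtf.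
move: fk' => [f' fd f'k].
exists (fun t => 2^-1 * f' t * (Num.sqrt (f t))^-1).
  move=> t; have := is_derive_sqrtf (f0 t) (fd t).
  by congr (is_derive t 1 _ _); rewrite invfM; ring.
apply: radM; first by apply: radM => //; exact: rad_cst.
by apply: radV; [move=> t; rewrite gt_eqF// sqrtr_gt0|apply/IH/radW].
Qed.

Lemma rad_exp k f : rad k f -> rad k (fun t => expR (f t)).
Proof.
elim: k => [|k IH] /[dup] fk [fe fk']; split;
  try by move=> t; rewrite fe.
  by apply: continuous_compf => //; exact: continuous_expR.
move: fk' => [f' fd f'k].
exists (fun t => f' t * expR (f t)); last by apply: radM => //; apply/IH/radW.
move=> t; have := is_derive_compf (is_derive_expR (f t)) (fd t).
by congr (is_derive t 1 _ _); ring.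
Qed.

Lemma avg_shift m u t : continuous u ->
  avg m.+1 (fun s => s * u s) t = t * avg m.+2 u t.
Proof.
move=> uc; rewrite /avg; have [->|t0] := eqVneq t 0; first by rewrite !mul0r.
rewrite (_ : (fun s => _) = fun s => s ^+ m.+2 * u s); last first.
  by apply/funext => s; rewrite mulrA -exprSr.
by rewrite !exprS; field; rewrite t0 expf_neq0.
Qed.

(** Here [D (avg m u) = avg m.+2 (D u)]: differentiating raises the exponent by one, and the factor
    [s] in [u' = s D u] raises it once more. *)
Lemma rad_avg k m u : rad k u -> rad k (avg m u).
Proof.
elim: k m u => [|k IH] m u /[dup] uk [ue uk']; split;
  try by apply: avg_even => //; exact: rad_continuous uk.
  exact: continuous_avg.
move: uk' => [u' ud u'k]; exists (avg m.+2 u'); last exact: IH.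
have u'c := rad_continuous u'k.
move=> t; rewrite -avg_shift//; apply: is_derive_avg => //.
by apply: continuousMf => //; exact: continuousIf.
Qed.

(** Writing [f] as the integral of [s g(s)] exhibits [f / t^2] as an average of [D f], which
    inherits its regularity by [rad_avg]. *)
Lemma rad_div_sqr k f g : rad k g -> f 0 = 0 ->
  (forall t, is_derive t 1 f (t * g t)) -> forall t, f t = t ^+ 2 * avg 1 g t.
Proof.
move=> gk f0 fd t; rewrite /avg; have [->|t0] := eqVneq t 0.
  by rewrite expr0n /= mul0r.
have fd1 s : is_derive s 1 f (s ^+ 1 * g s) by rewrite expr1.
rewrite (primitive_unique (avg_integrand (rad_continuous gk)) f0 fd1).
by rewrite mulrC divfK// expf_neq0.
Qed.

Fixpoint Cr k f : Prop :=
  match k with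
  | 0 => continuous f
  | k'.+1 => exists2 g, (forall t, is_derive t 1 f (g t)) & Cr k' g
  end.

Lemma Cr_continuous k f : Cr k f -> continuous f.
Proof. by case: k => // k [g fd _] t; exact: is_derive_continuous (fd t). Qed.

Lemma Cr_avg k m u : Cr k u -> Cr k (avg m u).
Proof.
elim: k m u => [|k IH] m u; first exact: continuous_avg.
move=> [u' ud u'k]; exists (avg m.+1 u'); last exact: IH.
by apply: is_derive_avg => //; exact: Cr_continuous u'k.
Qed.

(** Each application of [D] costs two ordinary derivatives: [f'] is odd, so [f'(t) / t] is the mean
    of [f''] over [[0, t]], that is [avg 0 f'']. *)
Lemma even_Cr_rad k f : (forall t, f (- t) = f t) -> Cr k.*2 f -> rad k f.
Proof.
elim: k f => [//|k IH] f fe [f' fd [f'' f'd f''k]]; split=> //.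
have f'o t : f' (- t) = - f' t.
  have := is_derive_opp (fd (- t)).
  under eq_fun do rewrite fe.
  by move=> /(is_derive_unique (fd t)) ->; rewrite opprK.
have f''e t : f'' (- t) = f'' t.
  have := is_derive_opp (f'd (- t)).
  under eq_fun do rewrite f'o.
  by move=> /(is_derive_unique (is_deriveNf (f'd t)))/oppr_inj ->.
have f''c := Cr_continuous f''k.
have f'0 : f' 0 = 0 by have := f'o 0; rewrite oppr0; lra.
exists (avg 0 f''); last by apply: IH; [exact: avg_even|exact: Cr_avg].
move=> t; suff -> : t * avg 0 f'' t = f' t by [].
rewrite /avg; case: eqVneq => [->|t0]; first by rewrite mul0r f'0.
have f'd1 s : is_derive s 1 f' (s ^+ 0 * f'' s) by rewrite expr0 mul1r.
rewrite (primitive_unique (avg_integrand f''c) f'0 f'd1).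
by rewrite expr1 mulrC divfK.
Qed.

End RadialClass.

(** * Singular initial value problems *)

Section FixedPoint.
Context {R : realType}.
Implicit Types (f g u v y K : R -> R) (s t a b x c e : R) (m n : nat).

Definition even_continuous f := continuous f /\ forall t, f (- t) = f t.

Lemma geometric_small a e (th : R) : 0 <= th < 1 -> 0 < e ->
  exists n : nat, a * th ^+ n < e.
Proof.
move=> /andP[th0 th1] e0.
have : th ^+ n @[n --> \oo] --> (0 : R).
  by apply: cvg_expr; rewrite ger0_norm.
move=> /(@cvgMr _ _ _ _ _ a); rewrite mulr0 => /cvgrPdist_lt/(_ _ e0)[n _ /(_ n (leqnn n))].
rewrite /= sub0r normrN => H; exists n; rewrite (le_lt_trans _ H)//.
by rewrite mulrC ler_norm.
Qed.

(** Banach's theorem for the norm [sup |u| / W], without a complete function space. The limit is a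
    pointwise supremum of the lower bounds [lo]; since [W] is locally bounded the convergence is
    locally uniform, which gives continuity. *)
Lemma weighted_contraction (Phi : (R -> R) -> R -> R) (W : R -> R) (th C : R) :
  even_continuous W -> (forall t, 0 < W t) -> 0 <= th < 1 -> 0 <= C ->
  (forall u, even_continuous u -> even_continuous (Phi u)) ->
  (forall u v c, even_continuous u -> even_continuous v -> 0 <= c ->
     (forall t, `|u t - v t| <= c * W t) ->
     forall t, `|Phi u t - Phi v t| <= th * c * W t) ->
  (forall t, `|Phi (fun=> 0) t| <= C * W t) ->
  exists2 u, even_continuous u & Phi u = u.
Proof.
move=> [Wc We] W0 th01 C0 PhiEC PhiL Phi0; have /andP[th0 th1] := th01.
pose un n := iter n Phi (fun=> 0).
have unEC n : even_continuous (un n).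
  elim: n => [|n IH]; last exact: PhiEC.
  by split => //; exact: continuousCf.
have step n t : `|un n.+1 t - un n t| <= C * th ^+ n * W t.
  elim: n t => [|n IH] t; first by rewrite expr0 mulr1 subr0; exact: Phi0.
  rewrite exprS mulrCA; apply: (PhiL (un n.+1) (un n) _ (unEC _) (unEC _)) => //.
  by rewrite mulr_ge0// exprn_ge0.
(* [D th^n] is the tail of the geometric series of the steps [C th^k]; subtracting or adding it
   makes [lo] nondecreasing and [hi] nonincreasing in [n]. *)
pose D := C / (1 - th).
have D0 : 0 <= D by rewrite divr_ge0// subr_ge0 ltW.
have DC : D * (1 - th) = C by rewrite divfK// subr_eq0 eq_sym lt_eqF.
pose lo t n := un n t - D * th ^+ n * W t.
pose hi t n := un n t + D * th ^+ n * W t.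
have CD n t : C * th ^+ n * W t = D * th ^+ n * W t - D * th ^+ n.+1 * W t.
  by rewrite -DC exprS; ring.
have lo_mono t n k : lo t n <= lo t (k + n)%N.
  elim: k => [//|k IH]; apply: (le_trans IH); rewrite addSn /lo.
  by have := step (k + n)%N t; rewrite CD ler_norml; lra.
have hi_mono t n k : hi t (k + n)%N <= hi t n.
  elim: k => [//|k IH]; apply: le_trans IH; rewrite addSn /hi.
  by have := step (k + n)%N t; rewrite CD ler_norml; lra.
have DW n t : 0 <= D * th ^+ n * W t.
  apply: mulr_ge0; last exact: ltW.
  by apply: mulr_ge0 => //; exact: exprn_ge0.
have lo_hi t n k : lo t n <= hi t k.
  apply: (le_trans (lo_mono t n k)); apply: le_trans (hi_mono t k n).
  by rewrite addnC /lo /hi; have := DW (n + k)%N t; lra.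
pose u t := sup [set lo t n | n in [set: nat]].
have u_near n t : `|u t - un n t| <= D * th ^+ n * W t.
  have hs : has_sup [set lo t n | n in [set: nat]].
    split; first by exists (lo t 0%N); exists 0%N.
    by exists (hi t 0%N) => _ [k _ <-]; exact: lo_hi.
  have H1 : lo t n <= u t by apply: sup_upper_bound => //; exists n.
  have H2 : u t <= hi t n by apply: ge_sup; [case: hs|move=> _ [k _ <-]; exact: lo_hi].
  by rewrite ler_norml; move: H1 H2; rewrite /lo /hi; lra.
have uEC : even_continuous u.
  split; last first.
    move=> t; rewrite /u; congr sup; apply/seteqP.
    by split=> _ [n _ <-]; exists n => //; rewrite /lo We (unEC n).2.
  move=> t; apply/continuous_epsdelta => e e0.
  have [n ne] := @geometric_small (D * (W t + 1)) (e / 3) th th01 ltac:(lra).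
  have /continuous_epsdelta/(_ _ ltr01)[d d0 Wd] := Wc t.
  have /continuous_epsdelta/(_ (e / 3) ltac:(lra))[d' d'0 ud] := (unEC n).1 t.
  exists (Num.min d d'); first by rewrite lt_min d0.
  move=> x; rewrite lt_min => /andP[/Wd xd /ud xd'].
  have Wx : W x <= W t + 1 by move: xd; rewrite ltr_norml; lra.
  have bd z : W z <= W t + 1 -> `|u z - un n z| < e / 3.
    move=> Wz; apply: (le_lt_trans (u_near n z)); apply: le_lt_trans ne.
    by rewrite [leRHS]mulrAC ler_wpM2l// mulr_ge0// exprn_ge0.
  have := bd x Wx; have := bd t ltac:(lra).
  by move: xd'; rewrite !ltr_norml; lra.
exists u => //; apply/funext => t; apply/eqP; rewrite -subr_eq0 -normr_eq0.
apply/negPn/negP => n0.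
have pos : 0 < `|Phi u t - u t| by rewrite lt_def n0 normr_ge0.
have [n] := @geometric_small (2 * D * W t) _ th th01 pos.
apply/negP; rewrite -leNgt.
have H1 := PhiL _ _ _ uEC (unEC n) (mulr_ge0 D0 (exprn_ge0 n th0)) (u_near n) t.
have H2 := u_near n.+1 t.
have H3 : th * (D * th ^+ n) * W t <= D * th ^+ n * W t.
  by rewrite -!mulrA ler_piMl ?(ltW th1)// !mulrA.
have H4 : D * th ^+ n.+1 * W t <= D * th ^+ n * W t.
  by rewrite exprS mulrCA.
have := ler_distD (un n.+1 t) (Phi u t) (u t).
rewrite [`|un _ _ - _|]distrC.
by change (Phi (un n)) with (un n.+1) in H1; lra.
Qed.

Lemma avgB m u v t : continuous u -> continuous v ->
  avg m (fun s => u s - v s) t = avg m u t - avg m v t.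
Proof.
move=> uc vc; rewrite /avg; have [_|t0] := eqVneq t 0; first by rewrite mulrBl.
pose F s := primitive (fun s : R => s ^+ m * u s) s - primitive (fun s : R => s ^+ m * v s) s.
have F0 : F 0 = 0 by rewrite /F !primitive0 ?subrr//; exact: avg_integrand.
have Fd s : is_derive s 1 F (s ^+ m * (u s - v s)).
  rewrite mulrBr; apply: is_deriveBf; apply: is_derive_primitive; exact: avg_integrand.
have wc : continuous (fun s => u s - v s) by apply: continuousDf => //; exact: continuousNf.
by rewrite (primitive_unique (avg_integrand wc) F0 Fd t) /F mulrBl.
Qed.

Lemma avg_le m y z t : continuous y -> continuous z -> 0 <= t ->
  (forall s, 0 <= s -> `|y s| <= z s) -> `|avg m y t| <= avg m z t.
Proof.
move=> yc zc; rewrite le_eqVlt => /predU1P[<-|t0] yz.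
  by rewrite !avg0 normrM [`|_^-1|]ger0_norm ?invr_ge0// ler_wpM2r ?invr_ge0// yz.
have [Y0 Yd] := primitiveP (avg_integrand (m:=m) yc).
have [Z0 Zd] := primitiveP (avg_integrand (m:=m) zc).
rewrite /avg (gt_eqF t0) normrM normfV normrX (gtr0_norm t0).
apply: ler_wpM2r; first by rewrite invr_ge0 exprn_ge0// ltW.
rewrite ler_norml; move: Y0 Yd Z0 Zd; set Y := primitive _; set Z := primitive _ => Y0 Yd Z0 Zd.
have H1 : Z 0 - Y 0 <= Z t - Y t.
  apply: (@ge0_derive_le _ (fun s => Z s - Y s) (fun s => s ^+ m * z s - s ^+ m * y s)) => [|x _|x /andP[x0 _]].
  - exact: ltW.
  - exact: is_derive_continuous (is_deriveBf (Zd x) (Yd x)).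
  - rewrite -mulrBr; apply: mulr_ge0; rewrite ?subr_ge0 ?exprn_ge0 ?(ltW x0)//.
    by rewrite (le_trans (ler_norm _))// yz// ltW.
have H2 : Z 0 + Y 0 <= Z t + Y t.
  apply: (@ge0_derive_le _ (fun s => Z s + Y s) (fun s => s ^+ m * z s + s ^+ m * y s)) => [|x _|x /andP[x0 _]].
  - exact: ltW.
  - exact: is_derive_continuous (is_deriveDf (Zd x) (Yd x)).
  - rewrite -mulrDr -[y x]opprK; apply: mulr_ge0; rewrite ?subr_ge0 ?exprn_ge0 ?(ltW x0)//.
    by rewrite (le_trans (ler_norm _))// normrN yz// ltW.
by apply/andP; move: H1 H2; rewrite Y0 Z0; split; lra.
Qed.

Lemma avg_unique m y z t : continuous y -> continuous z ->
  (forall s, is_derive s 1 (fun x => x ^+ m.+1 * z x) (s ^+ m * y s)) ->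
  avg m y t = z t.
Proof.
move=> yc zc zd.
suff : avg m y = z by move->.
apply: punctured_eq => //; first exact: continuous_avg.
move=> s s0; rewrite /avg (negPf s0) (primitive_unique (avg_integrand yc) _ zd).
  by rewrite mulrC mulKf// expf_neq0.
by rewrite exprS !mul0r.
Qed.

(** A Bielecki weight: its logarithmic derivative [2 (m+1) K] is large enough to dominate the
    Lipschitz growth [t K] under [avg m]. *)
Definition weight m K t := expR (m.+1.*2%:R * primitive K `|t|).

Lemma weight_even_continuous m K : continuous K -> even_continuous (weight m K).
Proof.
move=> Kc; split; last by move=> t; rewrite /weight normrN.
apply: continuous_compf; first exact: continuous_expR.
apply: continuousMf; first exact: continuousCf.
apply: continuous_compf; last exact/continuous_normf/continuousIf.
by move=> t; exact: is_derive_continuous (is_derive_primitive t Kc).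
Qed.

Lemma weight_mono m K s t : continuous K -> (forall t, 0 <= K t) ->
  0 <= s <= t -> weight m K s <= weight m K t.
Proof.
move=> Kc K0 /andP[s0 st]; rewrite /weight ler_expR ler_wpM2l//.
rewrite !ger0_norm ?(le_trans s0 st)//.
apply: (@ge0_derive_le _ _ K) => // x _.
  by exact: is_derive_continuous (is_derive_primitive x Kc).
exact: is_derive_primitive.
Qed.

Lemma weight_ge1 m K t : continuous K -> (forall t, 0 <= K t) -> 1 <= weight m K t.
Proof.
move=> Kc K0; have H : weight m K 0 = 1.
  by rewrite /weight normr0 primitive0// mulr0 expR0.
rewrite -H -[weight m K t](_ : weight m K `|t| = _); last first.
  by rewrite /weight normr_id.
by apply: weight_mono => //; rewrite lexx/=.
Qed.

(** The factor [th = 1 - 1 / (2 (m+1))] lies strictly between [m / (m+1)] and 1. It works because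
    [th (m+1) = m + 1/2 >= m] and [th 2 (m+1) = 2 m + 1 >= 1]. *)
Lemma avg_weight_bound m K y c t : (0 < m)%N -> continuous K -> (forall t, 0 <= K t) ->
  even_continuous y -> 0 <= c ->
  (forall t, 0 <= t -> `|y t| <= c * ((m%:R + t * K t) * weight m K t)) ->
  `|avg m y t| <= (1 - (m.+1.*2)%:R^-1) * c * weight m K t.
Proof.
move=> m0 Kc K0 [yc ye] c0 yb.
wlog t0 : t / 0 <= t.
  move=> H; have [/H//|/ltW t0] := leP 0 t.
  rewrite -avg_even// -(weight_even_continuous m Kc).2.
  by apply: H; rewrite oppr_ge0.
set W := weight m K; set th := 1 - _.
have [Wc We] := weight_even_continuous m Kc.
pose W' s := expR (m.+1.*2%:R * primitive K s).
have W'W s : 0 <= s -> W s = W' s by move=> s0; rewrite /W /weight ger0_norm.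
have W'd s : is_derive s 1 W' (m.+1.*2%:R * K s * W' s).
  apply: is_derive_eq.
    by apply: is_derive_compf; apply: is_deriveMf; exact: is_derive_primitive.
  by rewrite mul0r add0r mulrC.
(* [z] is [t d/dt + (m+1)] applied to [th c W'], hence [avg m z = th c W'], and the claim reduces to
   [|y| <= z]. *)
pose z s := th * c * (m.+1%:R + s * (m.+1.*2%:R * K s)) * W' s.
have W'c := derivable_continuous W'd.
have zc : continuous z.
  apply: continuousMf => //; apply: continuousMf; first exact: continuousCf.
  apply: continuousDf; first exact: continuousCf.
  apply: continuousMf; first exact: continuousIf.
  by apply: continuousMf => //; exact: continuousCf.
have -> : th * c * W t = avg m z t.
  rewrite W'W//; symmetry; apply: (@avg_unique _ _ (fun s => th * c * W' s)) => //.
    by apply: continuousMf => //; exact: continuousCf.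
  move=> s; have := is_deriveMf (is_deriveXf m.+1 (is_deriveIf s))
    (is_deriveMf (is_deriveCf (th * c) s) (W'd s)).
  by congr (is_derive s 1 _ _); rewrite /z /= exprS; ring.
apply: avg_le => // s s0; apply: (le_trans (yb s s0)).
rewrite /z -/W W'W// mulrA; apply: ler_wpM2r; first exact: expR_ge0.
rewrite [th * c]mulrC -mulrA ler_wpM2l//.
have M2 : (m.+1.*2)%:R = 2 * m.+1%:R :> R by rewrite -muln2 natrM mulrC.
have thE : th = 1 - (2 * m.+1%:R)^-1 by rewrite /th M2.
have M0 : 0 < m.+1%:R :> R by rewrite ltr0n.
rewrite mulrDr lerD//.
  rewrite thE mulrBl mul1r -natr1 invfM -mulrA mulVf ?natr1 ?gt_eqF// mulr1.
  by rewrite -natr1; lra.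
rewrite mulrCA ler_wpM2l// mulrA ler_peMl//.
rewrite M2 thE mulrBl mul1r mulVf ?gt_eqF// ?mulr_gt0//.
have : 1 <= m.+1%:R :> R by rewrite ler1n.
by lra.
Qed.

Lemma bounded_on_unit y : continuous y -> exists2 C : R, 0 <= C &
  forall t, 0 <= t <= 1 -> `|y t| <= C.
Proof.
move=> yc.
have [|c _ H] := @EVT_max _ (fun t => `|y t|) 0 1 ler01.
  by apply: continuous_subspaceT; exact: continuous_normf.
by exists `|y c| => // t t01; apply: H; rewrite in_itv.
Qed.

(* At 0 the operator [avg m] contracts by [1/(m+1)], which beats the Lipschitz
   constant [m]; away from 0 the weight absorbs the growth [t K(t)]. *)
Theorem singular_fixpoint m (X : (R -> R) -> R -> R) K :
  (0 < m)%N ->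
  (forall u, even_continuous u -> even_continuous (X u)) ->
  continuous K -> (forall t, 0 <= K t) ->
  (forall u v E, even_continuous u -> even_continuous v -> even_continuous E ->
     (forall t, 0 <= E t) -> (forall s t, 0 <= s <= t -> E s <= E t) ->
     (forall t, `|u t - v t| <= E t) ->
     forall t, 0 <= t -> `|X u t - X v t| <= (m%:R + t * K t) * E t) ->
  exists2 u, even_continuous u & forall t, u t = avg m (X u) t.
Proof.
move=> m0 XEC Kc K0 XL.
pose o := (fun=> 0) : R -> R.
have oEC : even_continuous o by split => //; exact: continuousCf.
(* Adding [|X 0|] to [K] lets the weight also control the first iterate: on [[0, 1]] by the bound
   [C], and beyond 1 by [t K']. *)
pose K' t := K t + `|X o t|.
have K'c : continuous K'.
  by apply: continuousDf => //; apply: continuous_normf; exact: (XEC _ oEC).1.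
have K'0 t : 0 <= K' t by rewrite addr_ge0.
have [C C0 CX] := bounded_on_unit (XEC _ oEC).1.
set W := weight m K'.
have W1 t : 1 <= W t by exact: weight_ge1.
have W0 t : 0 < W t by apply: lt_le_trans (W1 t).
have WEC : even_continuous W by exact: weight_even_continuous.
have avgEC u : even_continuous u -> even_continuous (avg m u).
  by move=> [uc ue]; split; [exact: continuous_avg|exact: avg_even].
pose th : R := 1 - (m.+1.*2)%:R^-1.
have th01 : 0 <= th < 1.
  by rewrite /th subr_ge0 invf_le1 ?ltr0n// ler1n gtrBl invr_gt0 ltr0n.
have [||||u uEC uE] := @weighted_contraction (fun u => avg m (X u)) W th (th * (1 + C)) WEC W0 th01; last first.
- by exists u => // t; rewrite {1}uE.
- move=> t; apply: avg_weight_bound => //; first exact: XEC.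
    by rewrite addr_ge0.
  move=> s s0; have m1 : 1 <= m%:R :> R by rewrite ler1n.
  have sK : 0 <= s * K' s by rewrite mulr_ge0.
  have H : `|X o s| <= (1 + C) * (m%:R + s * K' s).
    have [s1|/ltW s1] := leP s 1.
      rewrite (le_trans (CX s _)) ?s0//.
      have : 0 <= C * (m%:R - 1) by rewrite mulr_ge0// subr_ge0.
      have : 0 <= C * (s * K' s) by rewrite mulr_ge0.
      lra.
    have : `|X o s| <= s * K' s.
      rewrite (le_trans _ (ler_peMl _ _))// /K'.
      by have := K0 s; lra.
    have : 0 <= C * m%:R by rewrite mulr_ge0.
    have : 0 <= C * (s * K' s) by rewrite mulr_ge0.
    lra.
  rewrite mulrA (le_trans H)// ler_peMr// mulr_ge0 ?addr_ge0//.
- move=> u v c uEC vEC c0 uv t; rewrite -avgB; [|exact: (XEC _ uEC).1|exact: (XEC _ vEC).1].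
  apply: avg_weight_bound => //.
    have [Xuc Xue] := XEC _ uEC; have [Xvc Xve] := XEC _ vEC.
    split; first by apply: continuousDf => //; exact: continuousNf.
    by move=> s; rewrite Xue Xve.
  move=> s s0; have := XL u v (fun s => c * W s) uEC vEC.
  move=> /(_ _ _ _ uv s s0) H; apply: le_trans (H _ _ _) _.
  + split; last by move=> x; rewrite WEC.2.
    by apply: continuousMf; [exact: continuousCf|exact: WEC.1].
  + by move=> x; rewrite mulr_ge0// ltW.
  + by move=> x x' xx'; rewrite ler_wpM2l// weight_mono.
  rewrite mulrCA ler_wpM2l// ler_wpM2r ?(ltW (W0 s))// lerD2l ler_wpM2l//.
  by rewrite /K' lerDl.
- by move=> u /XEC; exact: avgEC.
- by apply: mulr_ge0; [case/andP: th01|exact: addr_ge0].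
Qed.

End FixedPoint.

(** * Linear singular equations and regularity of their solutions *)

Section LinearRegularity.
Context {R : realType}.
Implicit Types (f g u v w y z A B X : R -> R) (s t a b x c e : R) (k m n : nat).

Lemma rad_even_continuous k f : rad k f -> even_continuous f.
Proof. by move=> fk; split; [exact: rad_continuous fk|move=> t; exact: rad_even fk]. Qed.

Lemma even_continuousD f g : even_continuous f -> even_continuous g ->
  even_continuous (fun t => f t + g t).
Proof.
by move=> [fc fe] [gc ge]; split; [exact: continuousDf|move=> t; rewrite fe ge].
Qed.

Lemma even_continuousM f g : even_continuous f -> even_continuous g ->
  even_continuous (fun t => f t * g t).
Proof.
by move=> [fc fe] [gc ge]; split; [exact: continuousMf|move=> t; rewrite fe ge].
Qed.

Lemma near_neq t : t != 0 -> \forall s \near t, s != 0.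
Proof. by move=> t0; exact: open_neq. Qed.

(** [t^(m+1) z] is a primitive of [t^m y]. Continuity of [z] at 0 makes it vanish there and so
    excludes the homogeneous solution [t^-(m+1)]. *)
Lemma avg_of_ode m y z t : continuous y -> continuous z ->
  (forall s, s != 0 -> is_derive s 1 z ((y s - m.+1%:R * z s) / s)) ->
  avg m y t = z t.
Proof.
move=> yc zc zd; apply: avg_unique => // s.
have vc : continuous (fun s => s ^+ m * y s) by exact: avg_integrand.
have H x : x != 0 -> is_derive x 1 (fun x => x ^+ m.+1 * z x) (x ^+ m * y x).
  move=> x0; have := is_deriveMf (is_deriveXf m.+1 (is_deriveIf x)) (zd x x0).
  by congr (is_derive x 1 _ _); rewrite /= exprS; field.
have [->|/H//] := eqVneq s 0.
apply: (@is_derive_punctured _ _ (fun s => s ^+ m * y s)) => //.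
  by apply: continuousMf => //; exact: continuousXf.
exact: vc.
Qed.

(** Since [B 0 = 0], the Lipschitz constant [|B|] is below [1 <= m] on [|t| < d]; beyond [d] it is
    at most [t |B| / d], which is the growth that [singular_fixpoint] tolerates. *)
Lemma linear_singular_solution m A B : (0 < m)%N ->
  even_continuous A -> even_continuous B -> B 0 = 0 ->
  exists2 w, even_continuous w & forall t, w t = avg m (fun s => A s + B s * w s) t.
Proof.
move=> m0 AEC BEC B0; have [Bc Be] := BEC.
have /continuous_epsdelta/(_ _ ltr01)[d d0 Bd] := Bc 0.
pose K t := `|B t| / d.
apply: (@singular_fixpoint _ m (fun w s => A s + B s * w s) K) => //.
- by move=> w wEC; apply: even_continuousD => //; exact: even_continuousM.
- by apply: continuousMf; [exact: continuous_normf|exact: continuousCf].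
- by move=> t; rewrite divr_ge0// ltW.
- move=> u v E uEC vEC EEC E0 Em uv t t0.
  rewrite (_ : _ - _ = B t * (u t - v t)); last by ring.
  rewrite normrM ler_pM//.
  have m1 : 1 <= m%:R :> R by rewrite ler1n.
  have [td|td] := ltP t d.
    have := Bd t; rewrite subr0 B0 subr0 (ger0_norm t0) => /(_ td) H.
    have : 0 <= t * K t by rewrite !mulr_ge0// invr_ge0 ltW.
    lra.
  have : `|B t| <= t * K t.
    by rewrite /K mulrCA ler_peMr// ler_pdivlMr// mul1r.
  lra.
Qed.

(* For [t != 0] the quotient [u'/t] satisfies the linear equation obtained by
   differentiating [t u' + (m+1) u = X].  It agrees near 0 with the continuous
   solution [w] of that equation, because the square of [p], which is
   [t^(m+2) (u'/t - w)], is nonincreasing on the right of 0 and vanishes at 0. *)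
Lemma radial_derivative m u X A B :
  even_continuous u -> even_continuous X -> (forall t, u t = avg m X t) ->
  even_continuous A -> even_continuous B -> B 0 = 0 ->
  (forall t, t != 0 -> is_derive t 1 X
     (t * (A t + B t * ((X t - m.+1%:R * u t) / t ^+ 2)))) ->
  exists v, [/\ even_continuous v, forall t, is_derive t 1 u (t * v t)
    & forall t, v t = avg m.+2 (fun s => A s + B s * v s) t].
Proof.
move=> [uc ue] [Xc Xe] uX AEC BEC B0 Xd.
have [w [wc we] wE] := @linear_singular_solution m.+2 A B isT AEC BEC B0.
have [Ac Ae] := AEC; have [Bc Be] := BEC.
pose e t := X t - m.+1%:R * u t.
have m0 : m.+1%:R != 0 :> R by rewrite pnatr_eq0.
have e0 : e 0 = 0 by rewrite /e uX avg0 mulrC divfK// subrr.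
have ec : continuous e.
  by apply: continuousDf => //; apply/continuousNf/continuousMf => //; exact: continuousCf.
have ee t : e (- t) = e t by rewrite /e ue Xe.
have ud t : t != 0 -> is_derive t 1 u (e t / t).
  move=> t0; have -> : u = avg m X by apply/funext.
  by rewrite /e uX; exact: avg_solves.
have ed t : t != 0 -> is_derive t 1 e (t * (A t + B t * (e t / t ^+ 2)) - m.+1%:R * (e t / t)).
  move=> t0; have := is_deriveBf (Xd t t0) (is_deriveMf (is_deriveCf m.+1%:R t) (ud t t0)).
  by congr (is_derive t 1 _ _); rewrite -/(e t); ring.
have wd t : t != 0 -> is_derive t 1 w ((A t + B t * w t - m.+3%:R * w t) / t).
  move=> t0; have wX : w = avg m.+2 (fun s => A s + B s * w s) by apply/funext.
  rewrite {1}wX.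
  have := @avg_solves _ m.+2 (fun s => A s + B s * w s) t _ t0.
  rewrite -wE; apply.
  by apply: continuousDf => //; exact: continuousMf.
pose p t := t ^+ m * (e t - t ^+ 2 * w t).
have pc : continuous p.
  apply: continuousMf; first exact: continuousXf.
  by apply/continuousDf/continuousNf/continuousMf => //; exact: continuousXf.
(* Subtracting the equations of [u'/t] and [w] cancels [A] and leaves the homogeneous equation
   [t p' = (B - 1) p], where [B - 1] is negative near 0. *)
have pd t : t != 0 -> is_derive t 1 p ((B t - 1) * p t / t).
  move=> t0; have := is_deriveMf (is_deriveXf m (is_deriveIf t))
    (is_deriveBf (ed t t0) (is_deriveMf (is_deriveXf 2 (is_deriveIf t)) (wd t t0))).
  congr (is_derive t 1 _ _); rewrite /p.
  have -> : m%:R * t ^+ m.-1 = m%:R * (t ^+ m / t).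
    by case: (m) => [|k]; rewrite ?mul0r// exprSr mulfK.
  by rewrite -!natr1 /=; field.
have /continuous_epsdelta/(_ _ ltr01)[d d0 Bd] := Bc 0.
have p0 t : 0 < t -> t < d -> p t = 0.
  move=> t0 td; have p00 : p 0 = 0 by rewrite /p e0 (expr0n _ 2) mul0r subrr mulr0.
  have := @ge0_derive_le _ (fun s => - (p s * p s)) (fun s => - ((B s - 1) * p s / s * p s + p s * ((B s - 1) * p s / s))) 0 t (ltW t0).
  have H1 x : 0 < x < t -> is_derive x 1 (fun s => - (p s * p s))
     (- ((B x - 1) * p x / x * p x + p x * ((B x - 1) * p x / x))).
    move=> /andP[x0 _]; have pdx := pd x (lt0r_neq0 x0).
    exact: is_deriveNf (is_deriveMf pdx pdx).
  have H2 x : 0 <= x <= t -> {for x, continuous (fun s => - (p s * p s))}.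
    by move=> _; apply: continuousNf; exact: continuousMf.
  move=> /(_ H2 H1); rewrite p00 mul0r oppr0 oppr_ge0 => H.
  have pp : p t * p t == 0.
    rewrite eq_le -expr2 sqr_ge0 andbT expr2; apply: H => x /andP[x0 xt].
    have Bx : B x - 1 <= 0.
      have := Bd x; rewrite subr0 B0 subr0 (gtr0_norm x0) => /(_ (lt_trans xt td)).
      by rewrite ltr_norml; lra.
    rewrite [X in 0 <= X](_ : _ = (1 - B x) * (2 * x^-1 * (p x * p x))); last first.
      by rewrite /=; ring.
    rewrite mulr_ge0//; first by lra.
    by rewrite -expr2; apply: mulr_ge0; [rewrite divr_ge0// ltW|exact: sqr_ge0].
  by move: pp; rewrite mulf_eq0 orbb => /eqP.
have ew t : `|t| < d -> e t = t ^+ 2 * w t.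
  have ewp x : 0 < x -> x < d -> e x = x ^+ 2 * w x.
    move=> x0 xd; have := p0 x x0 xd; rewrite /p => /eqP.
    rewrite mulf_eq0 expf_eq0 (gt_eqF x0) andbF/= subr_eq0 => /eqP //.
  move=> td; have [t0|t0|->] := ltgtP t 0.
  - rewrite -ee -we -(sqrrN t); apply: ewp; first by rewrite oppr_gt0.
    by rewrite -(ltr0_norm t0).
  - by apply: ewp => //; rewrite -(gtr0_norm t0).
  - by rewrite e0 expr0n mul0r.
(* The quotient [u'/t] is [e / t^2]; filling in [w 0] at 0 makes it continuous because it equals [w]
   on [|t| < d]. *)
pose v t := if t == 0 then w 0 else e t / t ^+ 2.
have vw t : `|t| < d -> v t = w t.
  move=> td; rewrite /v; have [->//|t0] := eqVneq t 0.
  by rewrite ew// mulrC mulKf// expf_neq0.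
have vE t : t != 0 -> v t = e t / t ^+ 2 by rewrite /v => /negPf ->.
have vd t : t != 0 -> is_derive t 1 v ((A t + B t * v t - m.+3%:R * v t) / t).
  move=> t0; have t2 : t ^+ 2 != 0 by rewrite expf_neq0.
  have := is_deriveMf (ed t t0) (@is_deriveVf _ (fun s => s ^+ 2) t _ t2 (is_deriveXf 2 (is_deriveIf t))).
  have vn : \forall s \near t, e s * (s ^+ 2)^-1 = v s.
    by have := near_neq t0; apply: filterS => s s0; rewrite vE.
  move=> /(is_derive_near vn); congr (is_derive t 1 _ _).
  by rewrite vE// -[m.+3%:R]natr1 -[m.+2%:R]natr1 -natr1 /=; field.
have vc : continuous v.
  move=> t; have [->|t0] := eqVneq t 0; last exact: is_derive_continuous (vd t t0).
  apply/continuous_epsdelta => a a0.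
  have /continuous_epsdelta/(_ _ a0)[d' d'0 wdd] := wc 0.
  exists (Num.min d d'); first by rewrite lt_min d0.
  move=> x; rewrite lt_min subr0 => /andP[xd xd'].
  by rewrite !vw ?normr0//; apply: wdd; rewrite subr0.
exists v; split.
- by split=> // t; rewrite /v oppr_eq0 ee sqrrN.
- move=> t; have udv x : x != 0 -> is_derive x 1 u (x * v x).
    move=> x0; have := ud x x0; congr (is_derive x 1 _ _).
    by rewrite vE// ; field.
  have [->|/udv//] := eqVneq t 0.
  apply: (@is_derive_punctured _ _ (fun s => s * v s)) => //.
  by apply: continuousMf => //; exact: continuousIf.
- move=> t; symmetry; apply: avg_of_ode => //.
  by apply: continuousDf => //; exact: continuousMf.
Qed.

(** Applying [D] to [t v' + (m+1) v = A + B v] gives an equation of the same kind for [D v], with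
    [m + 2], the same [B], and source [D A + (D B) v]. Regularity of [v] up to order [k] makes that
    source regular enough for the induction. *)
Lemma rad_linear k m v A B : rad k A -> rad k B -> B 0 = 0 ->
  even_continuous v -> (forall t, v t = avg m (fun s => A s + B s * v s) t) ->
  rad k v.
Proof.
elim: k m v A B => [|k IH] m v A B Ak Bk B0 vEC vE.
  by case: vEC.
have vk : rad k v by exact: (IH m v A B (radW Ak) (radW Bk)).
move: (Ak) (Bk) => [_ [A' Ad A'k]] [_ [B' Bd B'k]].
have A1k : rad k (fun t => A' t + B' t * v t) by apply: radD => //; exact: radM.
have BEC := rad_even_continuous Bk.
have AEC := rad_even_continuous Ak.
have XEC : even_continuous (fun s => A s + B s * v s).
  by apply: even_continuousD => //; exact: even_continuousM.
have [|w [wEC wd wE]] := @radial_derivative m v _ _ B vEC XEC vE (rad_even_continuous A1k) BEC B0.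
  move=> t t0; have vd : is_derive t 1 v ((A t + B t * v t - m.+1%:R * v t) / t).
    have vX : v = avg m (fun s => A s + B s * v s) by apply/funext.
    have := avg_solves m XEC.1 t0; rewrite -vE; congr (is_derive t 1 _ _).
    by rewrite -vX.
  have := is_deriveDf (Ad t) (is_deriveMf (Bd t) vd).
  by congr (is_derive t 1 _ _); field.
split; first by case: vEC.
by exists w => //; exact: (IH m.+2 w _ _ A1k (radW Bk)).
Qed.

End LinearRegularity.

(** * The profile equation *)

Section Barrier.
Context {R : realType}.
Implicit Types (f g u v w y z A B X : R -> R) (s t a b x c e : R) (k m n : nat).

Lemma is_derive_mul_norm x : is_derive x 1 (fun y : R => y * `|y|) (2 * `|x|).
Proof.
have H s : s != 0 -> is_derive s 1 (fun y : R => y * `|y|) (2 * `|s|).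
  rewrite neq_lt => /orP[s0|s0].
  - apply: (@is_derive_near _ (fun y : R => - (y ^+ 2))).
      have := @lt_nbhsl _ s 0 s0; apply: filterS => r y0.
      by rewrite ltr0_norm// mulrN expr2.
    have := is_deriveNf (is_deriveXf 2 (is_deriveIf s)).
    by congr (is_derive s 1 _ _); rewrite ltr0_norm//=; ring.
  - apply: (@is_derive_near _ (fun y : R => y ^+ 2)).
      have : \forall r \near s, 0 < r by exact: lt_nbhsr.
      apply: filterS => r y0.
      by rewrite gtr0_norm// expr2.
    have := is_deriveXf 2 (is_deriveIf s).
    by congr (is_derive s 1 _ _); rewrite gtr0_norm//=; ring.
have nc : continuous (fun y : R => `|y|) by exact: continuous_normf continuousIf.
have [->|/H//] := eqVneq x 0.
apply: (@is_derive_punctured _ _ (fun y : R => 2 * `|y|)) => //.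
  by apply: continuousMf nc; exact: continuousIf.
by apply: continuousMf; [exact: continuousCf|exact: nc].
Qed.

(** [g = f |f| - f^2] is a differentiable substitute for the negative part: it is 0 where [f >= 0]
    and [-2 f^2] where [f < 0]. It is therefore nondecreasing, and no first exit time has to be
    discussed. *)
Lemma barrier f f' a b : a <= b -> continuous f ->
  (forall x, a < x < b -> is_derive x 1 f (f' x)) ->
  (forall x, a < x < b -> f x < 0 -> 0 <= f' x) ->
  0 <= f a -> 0 <= f b.
Proof.
move=> ab fc fd f'0 fa.
pose g x := f x * `|f x| - f x ^+ 2.
have gc : continuous g.
  apply: continuousDf.
    by apply: continuousMf => //; exact: continuous_normf.
  by apply/continuousNf/(continuous_compf (f := fun r : R => r ^+ 2)) => //; exact: continuousXf.
have gd x : a < x < b -> is_derive x 1 g (2 * `|f x| * f' x - 2 * f x * f' x).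
  move=> xab; have := is_deriveBf (is_derive_compf (is_derive_mul_norm (f x)) (fd x xab))
    (is_deriveXf 2 (fd x xab)).
  by congr (is_derive x 1 _ _); rewrite expr1.
have : g a <= g b.
  apply: (ge0_derive_le ab _ gd) => [x _|x xab]; first exact: gc.
  rewrite -mulrBl; have [f0|f0] := leP 0 (f x).
    by rewrite ger0_norm// subrr mul0r.
  rewrite mulr_ge0//; last exact: f'0.
  by rewrite ltr0_norm//; lra.
rewrite /g {1}ger0_norm// -expr2 subrr subr_ge0 leNgt; apply: contraNle => fb.
by rewrite ltr0_norm// expr2 mulrN; nra.
Qed.

Lemma punctured_ge0 f : continuous f -> (forall t, t != 0 -> 0 <= f t) ->
  forall t, 0 <= f t.
Proof.
move=> fc f0 t; rewrite (_ : f = fun t => `|f t|)//.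
by apply: punctured_eq => //; [exact: continuous_normf|move=> s /f0 /ger0_norm].
Qed.

Lemma even_ge0 f : (forall t, f (- t) = f t) -> (forall t, 0 <= t -> 0 <= f t) ->
  forall t, 0 <= f t.
Proof.
move=> fe f0 t; have [/f0//|/ltW t0] := leP 0 t.
by rewrite -fe; apply: f0; rewrite oppr_ge0.
Qed.

Lemma integral_even y : even_continuous y -> even_continuous (primitive (fun s => s * y s)).
Proof.
move=> [yc ye].
have xc : continuous (fun s => s * y s) by apply: continuousMf => //; exact: continuousIf.
have pd s : is_derive s 1 (primitive (fun s => s * y s)) (s * y s).
  exact: is_derive_primitive.
split; first exact: derivable_continuous pd.
move=> t; symmetry.
apply: (primitive_unique (F := fun t => primitive (fun s => s * y s) (- t))) => //.
  by rewrite oppr0 primitive0.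
move=> s; have := is_derive_opp (pd (- s)).
by congr (is_derive s 1 _ _); rewrite ye; ring.
Qed.

Lemma is_derive_integral y t : continuous y ->
  is_derive t 1 (primitive (fun s => s * y s)) (t * y t).
Proof.
move=> yc; apply: (@is_derive_primitive _ (fun s => s * y s)).
by apply: continuousMf => //; exact: continuousIf.
Qed.

(** The majorant is [f 0] plus the total variation of [f] on [[0, |t|]]. *)
Lemma monotone_majorant f : rad 1 f ->
  exists V, [/\ even_continuous V, forall t, f t <= V t
    & forall s t, 0 <= s <= t -> V s <= V t].
Proof.
move=> f1; have fEC := rad_even_continuous f1.
move: f1 => [fe [g fd [ge gc]]].
have gEC : even_continuous (fun s => `|g s|).
  by split; [exact: continuous_normf|move=> t; rewrite ge].
have [Ic Ie] := integral_even gEC.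
pose V t := f 0 + primitive (fun s => s * `|g s|) t.
have Vd t : is_derive t 1 V (t * `|g t|).
  have := is_deriveDf (is_deriveCf (f 0) t) (is_derive_integral t gEC.1).
  by congr (is_derive t 1 _ _); rewrite add0r.
have Vc := derivable_continuous Vd.
exists V; split.
- by split => // t; rewrite /V Ie.
- move=> t; rewrite -subr_ge0; apply: (@even_ge0 (fun t => V t - f t)) => [s|s s0].
    by rewrite /V Ie fe.
  have <- : V 0 - f 0 = 0.
    by rewrite /V primitive0 ?addr0 ?subrr//; apply: continuousMf gEC.1; exact: continuousIf.
  apply: (ge0_derive_le s0 (f' := fun x => x * `|g x| - x * g x)) => [x _|x /andP[x0 _]].
  + exact: is_derive_continuous (is_deriveBf (Vd x) (fd x)).
  + by rewrite -mulrBr mulr_ge0 ?(ltW x0)// subr_ge0 ler_norm.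
- move=> s t /andP[s0 st]; apply: (ge0_derive_le st _ (fun x _ => Vd x)) => x.
    by move=> _; exact: Vc.
  by move=> /andP[sx _]; rewrite mulr_ge0// ltW// (le_lt_trans s0).
Qed.

End Barrier.

Section Profile.
Context {R : realType}.
Implicit Types (f g u v w y A B X : R -> R) (t a b x c e r : R) (k m : nat).

Lemma primitive_integral_le (y z : R -> R) t (E : R) : continuous y -> continuous z -> 0 <= t ->
  (forall x, 0 <= x <= t -> `|y x| <= E * z x) ->
  `|primitive y t| <= E * primitive z t.
Proof.
move=> yc zc t0 yz; have [Y0 Yd] := primitiveP yc; have [Z0 Zd] := primitiveP zc.
have H (e : R) : e ^+ 2 = 1 -> 0 <= E * primitive z t - e * primitive y t.
  move=> e2; have -> : 0 = E * primitive z 0 - e * primitive y 0.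
    by rewrite Y0 Z0 !mulr0 subrr.
  have fd x : is_derive x 1 (fun x => E * primitive z x - e * primitive y x)
      (E * z x - e * y x).
    have := is_deriveBf (is_deriveMf (is_deriveCf E x) (Zd x)) (is_deriveMf (is_deriveCf e x) (Yd x)).
    by congr (is_derive x 1 _ _); ring.
  apply: (ge0_derive_le t0 _ (fun x _ => fd x)) => x.
    by move=> _; exact: is_derive_continuous (fd x).
  move=> /andP[x0 xt]; rewrite subr_ge0.
  apply: le_trans (yz x _); last by rewrite !ltW.
  rewrite (le_trans (ler_norm _))// normrM.
  suff -> : `|e| = 1 by rewrite mul1r.
  by apply/eqP; rewrite -sqrp_eq1// -normrX e2 normr1.
have := H 1 (expr1n _ _); have := H (-1) ltac:(by rewrite sqrrN expr1n).
by rewrite ler_norml mulN1r mul1r opprK => H1 H2; apply/andP; split; lra.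
Qed.

Lemma dist_max_le a b c : `|Num.max a c - Num.max b c| <= `|a - b|.
Proof.
have := ler_norm (a - b); have := ler_norm (- (a - b)); rewrite normrN => H1 H2.
by rewrite !maxEle ler_norml; case: (leP a c); case: (leP b c) => ? ?; lra.
Qed.

Lemma dist_min_le a b c : `|Num.min a c - Num.min b c| <= `|a - b|.
Proof.
have := ler_norm (a - b); have := ler_norm (- (a - b)); rewrite normrN => H1 H2.
by rewrite !minEle ler_norml; case: (leP a c); case: (leP b c) => ? ?; lra.
Qed.

(* [1/max(.,ka)] is nonincreasing with slope at least [-1/ka^2], which [a1 * id]
   with [a1 >= be/(2 ka^2)] compensates. *)
Lemma clamp_lipschitz a1 be ka a b : 0 < ka -> 0 <= be -> 0 <= a1 ->
  `|a1 * (a - b) + be * ((Num.max a ka)^-1 - (Num.max b ka)^-1)|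
    <= Num.max a1 (be / ka ^+ 2 - a1) * `|a - b|.
Proof.
move=> k0 be0 a10.
wlog ab : a b / b <= a.
  move=> H; have [/H//|/ltW/H] := leP b a.
  rewrite distrC; congr (_ <= _); rewrite -normrN; congr (`|_|); ring.
set U := Num.max a ka; set V := Num.max b ka.
have kU : ka <= U by rewrite le_max lexx orbT.
have kV : ka <= V by rewrite le_max lexx orbT.
have UV : 0 <= U - V <= a - b.
  rewrite /U /V !maxEle; case: (leP a ka); case: (leP b ka) => ? ?; lra.
have U0 : 0 < U by apply: lt_le_trans kU.
have V0 : 0 < V by apply: lt_le_trans kV.
have E : U^-1 - V^-1 = - ((U - V) / (U * V)) by field; rewrite !gt_eqF.
have H1 : 0 <= (U - V) / (U * V) by case/andP: UV => *; rewrite divr_ge0// mulr_ge0// ltW.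
have H2 : (U - V) / (U * V) <= (a - b) / ka ^+ 2.
  case/andP: UV => UV1 UV2; apply: ler_pM => //.
    by rewrite invr_ge0 mulr_ge0// ltW.
  rewrite lef_pV2 ?posrE ?mulr_gt0// ?exprn_gt0//.
  by rewrite expr2 ler_pM// ltW.
have ab0 : 0 <= a - b by lra.
rewrite (ger0_norm ab0) E.
have B1 : 0 <= be * ((U - V) / (U * V)) by rewrite mulr_ge0.
have B2 : be * ((U - V) / (U * V)) <= be / ka ^+ 2 * (a - b).
  by rewrite -mulrA [ka ^- 2 * _]mulrC ler_wpM2l.
have M1 : a1 * (a - b) <= Num.max a1 (be / ka ^+ 2 - a1) * (a - b).
  by rewrite ler_wpM2r// le_max lexx.
have M2 : (be / ka ^+ 2 - a1) * (a - b) <= Num.max a1 (be / ka ^+ 2 - a1) * (a - b).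
  by rewrite ler_wpM2r// le_max lexx orbT.
rewrite ler_norml mulrN; apply/andP; split.
  move: M2; rewrite mulrBl; lra.
lra.
Qed.

(* [N = n - 2], [e] is the sign of [phi], [S = sqrt (e phi / (n - 1))],
   [Q = e psi = |psi|] and [2 t beta = (t^2 |psi|)']. *)
Section Solution.
Variables (N : nat) (e : R) (S Q beta : R -> R).
Hypothesis e2 : e = 1 \/ e = -1.
Hypothesis Sr : forall k, rad k S.
Hypothesis Qr : forall k, rad k Q.
Hypothesis br : forall k, rad k beta.
Hypothesis S0 : forall t, 0 < S t.
Hypothesis b0 : forall t, 0 < beta t.
Hypothesis Qd : forall t, is_derive t 1 (fun t => t ^+ 2 * Q t) (2 * (t * beta t)).
Hypothesis b00 : beta 0 = N.+1%:R * S 0 ^+ 2.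

Let Sc : continuous S := rad_continuous (Sr 0).
Let Qc : continuous Q := rad_continuous (Qr 0).
Let bc : continuous beta := rad_continuous (br 0).
Let Se t : S (- t) = S t. Proof. exact: rad_even (Sr 0). Qed.
Let Qe t : Q (- t) = Q t. Proof. exact: rad_even (Qr 0). Qed.
Let be t : beta (- t) = beta t. Proof. exact: rad_even (br 0). Qed.

(** An a priori upper bound for [c]. If [e = 1], then [c] decreases from 1; if [e = -1], then
    [c' = t S u] and [u <= sqrt Q], and this is the integral of the resulting bound. *)
Definition chat t := 1 + primitive (fun s => s * (S s * Num.sqrt (Q s))) t.

Let SQc : continuous (fun s => S s * Num.sqrt (Q s)).
Proof. by apply: continuousMf => //; exact: continuous_sqrtf. Qed.

Let SQ_EC : even_continuous (fun s => S s * Num.sqrt (Q s)).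
Proof. by split => // t; rewrite Se Qe. Qed.

Let chatd t : is_derive t 1 chat (t * (S t * Num.sqrt (Q t))).
Proof.
have := is_deriveDf (is_deriveCf 1 t) (is_derive_integral t SQc).
by congr (is_derive t 1 _ _); rewrite add0r.
Qed.

Let chat_rad : rad 1 chat.
Proof.
split; first by move=> t; rewrite /chat (integral_even SQ_EC).2.
exists (fun s => S s * Num.sqrt (Q s)) => //.
by case: SQ_EC.
Qed.

Let chat0 : chat 0 = 1.
Proof.
rewrite /chat primitive0 ?addr0//; apply: continuousMf => //; exact: continuousIf.
Qed.

Lemma chat_ge1 t : 1 <= chat t.
Proof.
rewrite -subr_ge0; apply: (@even_ge0 _ (fun t => chat t - 1)) => [s|s s0].
  by rewrite (rad_even _ chat_rad).
have -> : 0 = chat 0 - 1 by rewrite chat0 subrr.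
rewrite lerD2r; apply: (ge0_derive_le s0 _ (fun x _ => chatd x)) => x.
  by move=> _; exact: is_derive_continuous (chatd x).
by move=> /andP[x0 _]; rewrite !mulr_ge0 ?sqrtr_ge0// ltW.
Qed.

(* If [x u' + u = beta/u - N S C] with [C <= chat] then [x (u - ka)] cannot become
   negative for a constant [0 < ka <= beta / (sqrt beta + N S chat)]. *)
Lemma lower_barrier_exists : exists ka, [/\ even_continuous ka, forall t, 0 < ka t,
  forall s t, 0 <= s <= t -> ka t <= ka s
  & forall t, ka t + N%:R * S t * chat t <= beta t / ka t].
Proof.
pose J t := (Num.sqrt (beta t) + N%:R * S t * chat t) / beta t.
have sb t : 0 < Num.sqrt (beta t) by rewrite sqrtr_gt0.
have NS t : 0 <= N%:R * S t * chat t.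
  rewrite !mulr_ge0// ?(ltW (S0 t))//.
  by rewrite (le_trans ler01)// chat_ge1.
have J0 t : 0 < J t by rewrite divr_gt0// ltr_wpDr.
have Jr : rad 1 J.
  apply: radM; last by apply: radV => // t; rewrite gt_eqF.
  apply: radD; first exact: rad_sqrt.
  by apply: radM => //; apply: radM => //; exact: rad_cst.
(* With [ka = 1 / V] and [V >= J] one gets both [ka <= sqrt beta] and
   [beta / ka >= sqrt beta + N S chat]. Monotonicity of [V] makes [ka t] a lower bound for [ka] on
   all of [[0, t]]. *)
have [V [[Vc Ve] JV Vm]] := monotone_majorant Jr.
have V0 t : 0 < V t by apply: lt_le_trans (JV t).
exists (fun t => (V t)^-1); split.
- split; first by apply: continuousVf => // t; rewrite gt_eqF.
  by move=> t; rewrite Ve.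
- by move=> t; rewrite invr_gt0.
- by move=> s t st; rewrite lef_pV2 ?posrE// Vm.
- move=> t; rewrite invrK.
  have H : Num.sqrt (beta t) + N%:R * S t * chat t <= beta t * V t.
    have -> : Num.sqrt (beta t) + N%:R * S t * chat t = beta t * J t.
      by rewrite /J [RHS]mulrC divfK// gt_eqF.
    by rewrite ler_wpM2l// ltW.
  rewrite (le_trans _ H)// lerD2r.
  rewrite -div1r ler_pdivrMr//.
  have H2 : Num.sqrt (beta t) <= beta t * V t.
    by rewrite (le_trans _ H)// lerDl.
  rewrite -(ler_pM2l (sb t)) mulr1 mulrA -expr2 sqr_sqrtr// ltW//.
Qed.


Section Clamped.
Variable ka : R -> R.
Hypothesis kaEC : even_continuous ka.
Hypothesis ka0 : forall t, 0 < ka t.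

Definition clamp u t := Num.max (u t) (ka t).
(** This is [c] recovered from [u] by integrating its equation, which turns the system into one
    nonlocal equation for [u]. *)
Definition slope u t := 1 - e * primitive (fun s => s * (S s * clamp u s)) t.
Definition clamped_slope u t := Num.min (slope u t) (chat t).
Definition clamped_rhs u t := beta t / clamp u t - N%:R * S t * clamped_slope u t.

Let clampEC u : even_continuous u -> even_continuous (clamp u).
Proof.
move=> [uc ue]; have [kc ke] := kaEC.
by split; [exact: continuous_maxf|move=> t; rewrite /clamp ue ke].
Qed.

Let SclampEC u : even_continuous u -> even_continuous (fun s => S s * clamp u s).
Proof. by move=> /clampEC; apply: even_continuousM. Qed.

Let clamp_gt0 u t : 0 < clamp u t.
Proof. by rewrite lt_max ka0 orbT. Qed.

Lemma slopeEC u : even_continuous u -> even_continuous (slope u).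
Proof.
move=> uEC; have [pc pe] := integral_even (SclampEC uEC).
split; last by move=> t; rewrite /slope pe.
apply: continuousDf; first exact: continuousCf.
by apply/continuousNf/continuousMf => //; exact: continuousCf.
Qed.

Lemma slope_derive u t : even_continuous u ->
  is_derive t 1 (slope u) (- (e * (t * (S t * clamp u t)))).
Proof.
move=> uEC; have := is_deriveBf (is_deriveCf 1 t)
  (is_deriveMf (is_deriveCf e t) (is_derive_integral t (SclampEC uEC).1)).
by congr (is_derive t 1 _ _); ring.
Qed.

Lemma slope0 u : even_continuous u -> slope u 0 = 1.
Proof.
move=> uEC; rewrite /slope primitive0 ?mulr0 ?subr0//.
by apply: continuousMf; [exact: continuousIf|exact: (SclampEC uEC).1].
Qed.

Let clamped_slopeEC u : even_continuous u -> even_continuous (clamped_slope u).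
Proof.
move=> /slopeEC[sc se]; have [cc ce] := rad_even_continuous chat_rad.
by split; [exact: continuous_minf|move=> t; rewrite /clamped_slope se ce].
Qed.

Let clamped_rhsEC u : even_continuous u -> even_continuous (clamped_rhs u).
Proof.
move=> uEC; have [kc ke] := clampEC uEC; have [cc ce] := clamped_slopeEC uEC.
split; last by move=> t; rewrite /clamped_rhs ke ce be Se.
apply: continuousDf.
  by apply: continuousMf => //; apply: continuousVf => // t; rewrite gt_eqF.
apply/continuousNf/continuousMf => //; apply: continuousMf => //.
exact: continuousCf.
Qed.

(** [slope] sees [u] on the whole of [[0, t]]; a nondecreasing bound [E] reduces all earlier
    differences to [E t]. The factor [t] comes from the integrand and matches the growth [t K] of
    [singular_fixpoint]. *)
Let slope_lipschitz u v (E : R -> R) t : even_continuous u -> even_continuous v ->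
  (forall s t, 0 <= s <= t -> E s <= E t) ->
  (forall t, `|u t - v t| <= E t) -> 0 <= t ->
  `|slope u t - slope v t| <= t * E t * primitive S t.
Proof.
move=> uEC vEC Em uv t0.
have Uc := (SclampEC uEC).1; have Vc := (SclampEC vEC).1.
pose y s := - e * (s * (S s * clamp u s) - s * (S s * clamp v s)).
have yc : continuous y.
  apply: continuousMf; first exact: continuousCf.
  by apply: continuousDf; [|apply: continuousNf]; apply: continuousMf => //; exact: continuousIf.
have -> : slope u t - slope v t = primitive y t.
  symmetry; apply: (primitive_unique (F := fun t => slope u t - slope v t)) => //.
    by rewrite !slope0// subrr.
  move=> s; have := is_deriveBf (slope_derive s uEC) (slope_derive s vEC).
  by congr (is_derive s 1 _ _); rewrite /y; ring.
apply: primitive_integral_le => // x /andP[x0 xt].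
have -> : y x = x * S x * - (e * (clamp u x - clamp v x)) by rewrite /y; ring.
have H : `|- (e * (clamp u x - clamp v x))| <= E t.
  rewrite normrN normrM (_ : `|e| = 1) ?mul1r; last first.
    by case: e2 => ->; rewrite ?normrN normr1.
  rewrite (le_trans (dist_max_le _ _ _))// (le_trans (uv x))// Em// x0//.
rewrite normrM ger0_norm; last by rewrite mulr_ge0// ltW.
by rewrite mulrAC ler_wpM2r ?(ltW (S0 x))// ler_pM.
Qed.

Lemma clamped_solution : exists2 u, even_continuous u &
  forall t, t != 0 -> is_derive t 1 u ((clamped_rhs u t - u t) / t).
Proof.
have [kc ke] := kaEC.
pose q t := beta t / ka t ^+ 2.
have q0 t : 0 <= q t by rewrite divr_ge0 ?sqr_ge0// ltW.
have qc : continuous q.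
  apply: continuousMf => //; apply: continuousVf => [t|].
    by rewrite expf_neq0// gt_eqF.
  by apply: (continuous_compf (f := fun r : R => r ^+ 2)) => //; exact: continuousXf.
(* Adding [m u] to both sides turns the equation into [t u' + (m+1) u = m u + rhs]. With [m > q 0]
   and [|q - q 0| < m] near 0 one has [q < 2 m], so [max(m, q - m)] from [clamp_lipschitz] is
   exactly [m] there. *)
have [m m0 qm] : exists2 m : nat, (0 < m)%N & q 0 < m%:R.
  exists (Num.bound (q 0)).+1 => //.
  by rewrite (lt_trans (archi_boundP (q0 0)))// ltr_nat.
have m1 : 1 <= m%:R :> R by rewrite ler1n.
have /continuous_epsdelta/(_ m%:R ltac:(lra))[d d0 qd] := qc 0.
have Sp t : 0 <= t -> 0 <= primitive S t.
  move=> t0; rewrite -(primitive0 Sc).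
  apply: (ge0_derive_le t0 _ (fun x _ => is_derive_primitive x Sc)) => x _.
    exact: is_derive_continuous (is_derive_primitive x Sc).
  exact: ltW.
pose K t := q t / d + N%:R * S t * `|primitive S t|.
have K0 t : 0 <= K t.
  apply: addr_ge0; first by rewrite divr_ge0// ltW.
  by rewrite mulr_ge0// mulr_ge0// ltW.
have Kc : continuous K.
  apply: continuousDf; first by apply: continuousMf => //; exact: continuousCf.
  apply: continuousMf; first by apply: continuousMf => //; exact: continuousCf.
  apply: continuous_normf.
  exact: derivable_continuous (fun x => is_derive_primitive x Sc).
pose X u t := m%:R * u t + clamped_rhs u t.
have XEC u : even_continuous u -> even_continuous (X u).
  move=> uEC; apply: even_continuousD; last exact: clamped_rhsEC.
  by apply: even_continuousM => //; split => //; exact: continuousCf.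
have [|u uEC uX] := @singular_fixpoint _ m X K m0 XEC Kc K0.
  move=> u v E uEC vEC EEC E0 Em uv t t0. 
  have -> : X u t - X v t =
      (m%:R * (u t - v t) + beta t * ((clamp u t)^-1 - (clamp v t)^-1))
      - N%:R * S t * (clamped_slope u t - clamped_slope v t).
    by rewrite /X /clamped_rhs; ring.
  apply: le_trans (ler_normB _ _) _.
  have H1 : `|m%:R * (u t - v t) + beta t * ((clamp u t)^-1 - (clamp v t)^-1)|
      <= Num.max m%:R (q t - m%:R) * E t.
    apply: le_trans (clamp_lipschitz (u t) (v t) (ka0 t) (ltW (b0 t)) (ler0n _ _)) _.
    by rewrite ler_wpM2l// le_max ler0n.
  have H2 : `|N%:R * S t * (clamped_slope u t - clamped_slope v t)|
      <= N%:R * S t * (t * E t * primitive S t).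
    have NS : 0 <= N%:R * S t by rewrite mulr_ge0// ltW.
    rewrite normrM (ger0_norm NS) ler_wpM2l// (le_trans (dist_min_le _ _ _))//.
    exact: slope_lipschitz.
  have H3 : Num.max m%:R (q t - m%:R) <= m%:R + t * (q t / d).
    have tq : 0 <= t * (q t / d) by rewrite mulr_ge0// divr_ge0// ltW.
    rewrite ge_max lerDl tq /=.
    have [td|td] := ltP t d.
      have := qd t; rewrite subr0 (ger0_norm t0) => /(_ td); rewrite ltr_norml; lra.
    have : q t <= t * (q t / d).
      by rewrite mulrCA ler_peMr// ler_pdivlMr// mul1r.
    lra.
  have H4 : Num.max m%:R (q t - m%:R) * E t <= (m%:R + t * (q t / d)) * E t.
    by rewrite ler_wpM2r.
  rewrite /K (ger0_norm (Sp t t0)).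
  have -> : (m%:R + t * (q t / d + N%:R * S t * primitive S t)) * E t =
    (m%:R + t * (q t / d)) * E t + N%:R * S t * (t * E t * primitive S t) by ring.
  by apply: lerD => //; exact: le_trans H1 H4.
exists u => // t t0.
have -> : u = avg m (X u) by apply/funext.
have := avg_solves m (XEC _ uEC).1 t0; congr (is_derive t 1 _ _).
have <- : u = avg m (X u) by apply/funext.
by rewrite /X -natr1; ring.
Qed.

End Clamped.


(** The clamps on the solution of [clamped_solution] are shown to be inactive, first [u >= ka] and
    then [c <= chat]; after that the equations hold unclamped. *)
Lemma profile_continuous_exists : exists u c : R -> R,
  [/\ even_continuous u, forall t, 0 < u t, c 0 = 1
    & forall t, is_derive t 1 c (t * - (e * S t * u t))] /\
  [/\ even_continuous c, forall t, t != 0 ->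
      is_derive t 1 u ((beta t / u t - N%:R * S t * c t - u t) / t)
    & forall t, t ^+ 2 * u t ^+ 2 = t ^+ 2 * Q t - e * N%:R * (1 - c t ^+ 2)].
Proof.
have [ka [kaEC ka0 kam kale]] := lower_barrier_exists.
have [u uEC ud] := clamped_solution kaEC ka0.
have [uc ue] := uEC; have [kc ke] := kaEC.
pose c := slope ka u.
have [cc ce] : even_continuous c by exact: slopeEC.
have chc : continuous chat := rad_continuous chat_rad.
have che t : chat (- t) = chat t by exact: rad_even chat_rad.
have ku t : ka t <= u t.
  rewrite -subr_ge0; move: t; apply: punctured_ge0 => [|t t0].
    by apply: continuousDf => //; exact: continuousNf.
  wlog tp : t t0 / 0 < t.
    move=> H; move: (t0); rewrite neq_lt => /orP[tn|tp]; last exact: H.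
    by rewrite -ue -ke; apply: H; [rewrite oppr_eq0|rewrite oppr_gt0].
  (* The level [ka t] is frozen on [[0, t]]. The factor [x] gives the value 0 at 0 and the
     derivative [clamped_rhs - ka t], which is nonnegative below the level because
     [ka t <= ka x]. *)
  have : 0 <= t * (u t - ka t).
    apply: (@barrier _ (fun x => x * (u x - ka t)) (fun x => clamped_rhs ka u x - ka t) 0 t (ltW tp)).
    - apply: continuousMf; first exact: continuousIf.
      by apply: continuousDf => //; exact: continuousCf.
    - move=> x /andP[x0 _]; have xn := lt0r_neq0 x0.
      have := is_deriveMf (is_deriveIf x) (is_deriveBf (ud x xn) (is_deriveCf (ka t) x)).
      by congr (is_derive x 1 _ _); field.
    - move=> x /andP[x0 xt]; rewrite pmulr_rlt0// subr_lt0 => ux.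
      have kx : ka t <= ka x by rewrite kam// !ltW.
      have -> : clamped_rhs ka u x = beta x / ka x - N%:R * S x * clamped_slope ka u x.
        rewrite /clamped_rhs; congr (_ / _ - _); rewrite /clamp.
        by rewrite max_r// ltW// (lt_le_trans ux).
      have H : N%:R * S x * clamped_slope ka u x <= N%:R * S x * chat x.
        rewrite ler_wpM2l ?mulr_ge0 ?(ltW (S0 x))//.
        by rewrite /clamped_slope ge_min lexx orbT.
      by have := kale x; lra.
    - by rewrite mul0r.
  by rewrite pmulr_rge0.
have u0 t : 0 < u t by apply: lt_le_trans (ku t).
have clu t : clamp ka u t = u t by rewrite /clamp max_l.
have cd t : is_derive t 1 c (t * - (e * S t * u t)).
  have := slope_derive kaEC t uEC; congr (is_derive t 1 _ _).
  by rewrite clu; ring.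
have c0 : c 0 = 1 by exact: slope0.
have cchat t : c t <= chat t.
  rewrite -subr_ge0; move: t; apply: even_ge0 => [t|t t0].
    by rewrite che ce.
  case: e2 => e1.
    rewrite subr_ge0 (le_trans _ (chat_ge1 t))// -c0 -lerN2.
    apply: (ge0_derive_le t0 _ (fun x _ => is_deriveNf (cd x))) => [x _|x /andP[x0 _]].
      by apply: continuousNf.
    by rewrite e1 mul1r mulrN opprK !mulr_ge0// ltW.
  have c1 x : 0 <= x -> 1 <= c x.
    move=> x0; rewrite -c0.
    apply: (ge0_derive_le x0 _ (fun x _ => cd x)) => [r _|r /andP[r0 _]]; first exact: cc.
    by rewrite e1 mulN1r mulNr opprK !mulr_ge0// ltW.
  (* For [e = -1] one has [c >= 1], so the clamped slope is nonnegative and [t^2 Q - (t u)^2], whose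
     derivative is a positive multiple of it, increases from 0. *)
  have uQ x : 0 < x -> u x <= Num.sqrt (Q x).
    move=> x0; rewrite -[u x](gtr0_norm (u0 x)) -sqrtr_sqr ler_wsqrtr//.
    rewrite -(@ler_pM2l _ (x ^+ 2)) ?exprn_gt0//.
    have Hd r : 0 < r < x -> is_derive r 1 (fun r => r ^+ 2 * Q r - (r * u r) ^+ 2)
       (2 * r * u r * (N%:R * S r * clamped_slope ka u r)).
      move=> /andP[r0 _]; have rn := lt0r_neq0 r0.
      have := is_deriveBf (Qd r) (is_deriveXf 2 (is_deriveMf (is_deriveIf r) (ud r rn))).
      congr (is_derive r 1 _ _); rewrite /clamped_rhs clu /=.
      by field; rewrite rn gt_eqF.
    have Hc r : 0 <= r <= x -> {for r, continuous (fun r => r ^+ 2 * Q r - (r * u r) ^+ 2)}.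
      move=> _; apply: (@continuousDf _ (fun r => r ^+ 2 * Q r) (fun r => - (r * u r) ^+ 2)).
        by apply: continuousMf => //; exact: continuousXf.
      apply: continuousNf; apply: (continuous_compf (f := fun r : R => r ^+ 2)).
        exact: continuousXf.
      by apply: continuousMf => //; exact: continuousIf.
    have := ge0_derive_le (ltW x0) Hc Hd.
    rewrite !(expr0n _ 2) !mul0r expr0n subrr subr_ge0 exprMn; apply.
    move=> r /andP[r0 _]; have C0 : 0 <= clamped_slope ka u r.
      rewrite /clamped_slope le_min (le_trans ler01 (c1 r (ltW r0)))/=.
      exact: le_trans ler01 (chat_ge1 r).
    by rewrite !mulr_ge0 ?(ltW r0) ?(ltW (u0 r)) ?(ltW (S0 r)).
  have -> : 0 = chat 0 - c 0 by rewrite chat0 c0 subrr.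
  apply: (ge0_derive_le t0 _ (fun x _ => is_deriveBf (chatd x) (cd x))) => [x _|x /andP[x0 _]].
    by apply: continuousDf => //; exact: continuousNf.
  rewrite e1 mulN1r mulNr opprK -mulrBr mulr_ge0 ?(ltW x0)// -mulrBr.
  by rewrite mulr_ge0 ?(ltW (S0 x))// subr_ge0 uQ.
have csl t : clamped_slope ka u t = c t by rewrite /clamped_slope min_l.
have udE t : t != 0 -> is_derive t 1 u ((beta t / u t - N%:R * S t * c t - u t) / t).
  by move=> /ud; rewrite /clamped_rhs csl clu.
exists u, c; split; split => // t.
(* A first integral: its derivative is a multiple of [e^2 - 1 = 0], and it vanishes at 0 because
   [c 0 = 1]. *)
pose F t := t ^+ 2 * u t ^+ 2 - (t ^+ 2 * Q t - e * N%:R * (1 - c t ^+ 2)).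
apply/eqP; rewrite -subr_eq0 -/(F t).
have Fe : F (- t) = F t by rewrite /F ue Qe ce sqrrN.
wlog t0 : t Fe / 0 <= t.
  move=> H; have [/H-> //|/ltW t0] := leP 0 t.
  by rewrite -Fe H ?opprK// oppr_ge0.
have Fd x : 0 < x < t -> is_derive x 1 F 0.
  move=> /andP[x0 _]; have xn := lt0r_neq0 x0.
  have := is_deriveBf (is_deriveMf (is_deriveXf 2 (is_deriveIf x)) (is_deriveXf 2 (udE x xn)))
   (is_deriveBf (Qd x) (is_deriveMf (is_deriveCf (e * N%:R) x)
     (is_deriveBf (is_deriveCf 1 x) (is_deriveXf 2 (cd x))))).
  congr (is_derive x 1 _ _).
  have ee : e * e = 1 by case: e2 => ->; rewrite ?mulr1 ?mulrNN ?mulr1.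
  transitivity (2 * N%:R * x * S x * u x * c x * (e * e - 1)); last by rewrite ee subrr mulr0.
  by rewrite /=; field; rewrite xn gt_eqF.
have sq_c (f : R -> R) : continuous f -> continuous (fun x => f x ^+ 2).
  by move=> fc; apply: (continuous_compf (f := fun r : R => r ^+ 2)) => //; exact: continuousXf.
have Fc : continuous F.
  apply: continuousDf.
    by apply: continuousMf; [exact: continuousXf|exact: sq_c].
  apply: continuousNf; apply: continuousDf.
    by apply: continuousMf => //; exact: continuousXf.
  apply: continuousNf; apply: continuousMf; first exact: continuousCf.
  apply: continuousDf; first exact: continuousCf.
  by apply: continuousNf; exact: sq_c.
have F0 : F 0 = 0 by rewrite /F c0 (expr0n _ 2) expr1n !mul0r subrr mulr0 subrr subrr.
move: t0; rewrite le_eqVlt => /predU1P[<-|t0]; first by rewrite F0.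
have [r _] := MVT_seg t0 (fun x _ => Fc x) Fd.
by rewrite mul0r F0 subr0 => ->.
Qed.

Theorem profile_exists : exists u c : R -> R,
  [/\ forall k, rad k u, forall k, rad k c, forall t, 0 < u t & c 0 = 1 /\ u 0 = S 0] /\
  [/\ forall t, is_derive t 1 c (t * - (e * S t * u t)),
    forall t, t != 0 ->
      is_derive t 1 u ((beta t / u t - N%:R * S t * c t - u t) / t)
    & forall t, t ^+ 2 * u t ^+ 2 = t ^+ 2 * Q t - e * N%:R * (1 - c t ^+ 2)].
Proof.
have [u [c [[uEC u0 c0 cd] [cEC ud id]]]] := profile_continuous_exists.
exists u, c; have [uc ue] := uEC; have [cc ce] := cEC.
have un0 t : u t != 0 by rewrite gt_eqF.
have ee : e ^+ 2 = 1 by case: e2 => ->; rewrite ?sqrrN expr1n.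
have [_ [b' bd [_ b'c]]] := br 1.
have [_ [S' Sd [_ S'c]]] := Sr 1.
have b'k k : rad k b' by exact: radD1 (br k.+1) bd b'c.
have S'k k : rad k S' by exact: radD1 (Sr k.+1) Sd S'c.
(* The summand [N.+1 u] is moved to the right so that the coefficient of [D u] in [D X], which is
   [B = N.+1 - beta / u^2], vanishes at 0. *)
pose X t := N.+1%:R * u t + (beta t / u t - N%:R * S t * c t).
have XEC : even_continuous X.
  split; last by move=> t; rewrite /X ue ce be Se.
  apply: continuousDf; first by apply: continuousMf => //; exact: continuousCf.
  apply: continuousDf.
    by apply: continuousMf => //; exact: continuousVf.
  apply: continuousNf; apply: continuousMf => //; apply: continuousMf => //.
  exact: continuousCf.
have uX t : u t = avg N.+1 X t.
  symmetry; apply: avg_of_ode => //; first by case: XEC.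
  move=> s s0; have := ud s s0; congr (is_derive s 1 _ _).
  by rewrite /X -[N.+2%:R]natr1; ring.
(* At [t = 0] the equation reads [(u - S) (u + (N+1) S) = 0], and the second factor is positive. *)
have us0 : u 0 = S 0.
  have := uX 0; rewrite avg0 /X c0 mulr1 b00 => H.
  have : (u 0 - S 0) * (u 0 + N.+1%:R * S 0) = 0.
    have : u 0 * N.+2%:R * u 0 = N.+1%:R * u 0 ^+ 2 + N.+1%:R * S 0 ^+ 2 - N%:R * S 0 * u 0.
      by rewrite {1}H divfK ?pnatr_eq0//; field; rewrite un0.
    by rewrite -!natr1; lra.
  move/eqP; rewrite mulf_eq0 subr_eq0 => /orP[/eqP//|].
  by rewrite gt_eqF// addr_gt0// mulr_gt0// ltr0n.
pose A t := b' t / u t - N%:R * (S' t * c t + S t * - (e * S t * u t)).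
pose B t := N.+1%:R - beta t / u t ^+ 2.
have B0 : B 0 = 0 by rewrite /B us0 b00 mulfK ?subrr// expf_neq0// gt_eqF.
have Ar k : rad k u -> rad k c -> rad k A.
  move=> uk ck; apply: radB; first by apply: radM => //; exact: radV.
  apply: radM; first exact: rad_cst.
  apply: radD; first by apply: radM.
  by apply: radM => //; apply: radN; do 2 apply: radM => //; exact: rad_cst.
have Br k : rad k u -> rad k B.
  move=> uk; apply: radB; first exact: rad_cst.
  apply: radM => //; apply: radV => [t|]; first by rewrite expf_neq0.
  exact: radX.
have Xd t : t != 0 -> is_derive t 1 X
    (t * (A t + B t * ((X t - N.+2%:R * u t) / t ^+ 2))).
  move=> t0; have := is_deriveDf (is_deriveMf (is_deriveCf N.+1%:R t) (ud t t0))
    (is_deriveBf (is_deriveMf (bd t) (is_deriveVf (un0 t) (ud t t0)))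
      (is_deriveMf (is_deriveMf (is_deriveCf N%:R t) (Sd t)) (cd t))).
  congr (is_derive t 1 _ _); rewrite /A /B /X -[N.+2%:R]natr1.
  by field; rewrite t0 un0.
have rc k : rad k u -> rad k.+1 c.
  move=> uk; split => //; exists (fun t => - (e * S t * u t)) => //.
  by apply: radN; do 2 apply: radM => //; exact: rad_cst.
have u00 : rad 0 u by [].
have c00 : rad 0 c by [].
have [v [vEC vd vE]] := radial_derivative uEC XEC uX
  (rad_even_continuous (Ar 0 u00 c00)) (rad_even_continuous (Br 0 u00)) B0 Xd.
(* Bootstrap: order [k] for [u] gives order [k + 1] for [c], hence order [k] for [A], [B] and, by
   [rad_linear], for [v = D u]. *)
have ru k : rad k u.
  elim: k => [//|k IH]; split => //; exists v => //.
  apply: rad_linear vEC vE => //; last exact: Br.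
  by apply: Ar => //; exact/radW/rc.
split; split => // k; exact/radW/rc.
Qed.

End Solution.
End Profile.

(** * Radial functions *)

Section RadialFunctions.
Context {R : realType} {n : nat}.
Implicit Types (F G : 'rV[R]_n -> R) (x y v : 'rV[R]_n) (f g : R -> R) (i j l : 'I_n) (k : nat).

(** Reduces directional derivatives to the one-variable rules above. *)
Lemma is_derive_line F x v (d : R) :
  is_derive x v F d <-> is_derive (0 : R) 1 (fun h : R => F (h *: v + x)) d.
Proof.
have E : 'D_1 (fun h : R => F (h *: v + x)) 0 = 'D_v F x.
  rewrite /derive; set g1 := fun h => h^-1 *: _; set g2 := fun h => h^-1 *: _.
  suff -> : g1 = g2 by [].
  by apply/funext => h; rewrite /g1 /g2 /= addr0 scale0r add0r [_%:A]mulr1.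
split=> -[H1 H2].
  by move/derivable1P in H1; apply: DeriveDef; rewrite ?E.
by apply: DeriveDef; [exact: (proj2 (derivable1P F x v) H1)|rewrite -E].
Qed.

Lemma is_derive_vD F G x v (a b : R) : is_derive x v F a -> is_derive x v G b ->
  is_derive x v (fun y => F y + G y) (a + b).
Proof. by move=> /is_derive_line Fa /is_derive_line Gb; apply/is_derive_line; exact: is_deriveDf. Qed.

Lemma is_derive_vM F G x v (a b : R) : is_derive x v F a -> is_derive x v G b ->
  is_derive x v (fun y => F y * G y) (a * G x + F x * b).
Proof.
move=> /is_derive_line Fa /is_derive_line Gb; apply/is_derive_line.
by have := is_deriveMf Fa Gb; rewrite scale0r add0r.
Qed.

Lemma is_derive_vV F x v (a : R) : F x != 0 -> is_derive x v F a ->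
  is_derive x v (fun y => (F y)^-1) (- a / F x ^+ 2).
Proof.
move=> F0 /is_derive_line Fa; apply/is_derive_line.
have := @is_deriveVf _ (fun h : R => F (h *: v + x)) 0 a; rewrite scale0r add0r; exact.
Qed.

Lemma is_derive_vC (c : R) x v : is_derive x v (fun=> c) (0 : R).
Proof. exact/is_derive_line/is_deriveCf. Qed.

Lemma is_derive_coord x i j :
  is_derive x (delta_mx 0 i) (fun y => y 0 j) ((i == j)%:R : R).
Proof.
apply/is_derive_line.
have := is_deriveDf (is_deriveMf (is_deriveIf 0) (is_deriveCf ((i == j)%:R : R) 0)) (is_deriveCf (x 0 j) (0 : R)).
rewrite mul1r mulr0 !addr0.
congr (is_derive _ _ _ _); apply/funext => h; rewrite !mxE eqxx /=.
by rewrite eq_sym.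
Qed.

Definition sqnorm x : R := \sum_(i < n) x 0 i ^+ 2.

Lemma sqnorm_ge0 x : 0 <= sqnorm x.
Proof. by apply: sumr_ge0 => i _; exact: sqr_ge0. Qed.

Lemma sqr_enorm x : enorm x ^+ 2 = sqnorm x.
Proof. by rewrite /enorm sqr_sqrtr// sqnorm_ge0. Qed.

Lemma enorm_ge0 x : 0 <= enorm x.
Proof. exact: sqrtr_ge0. Qed.

Lemma sqnorm_eq0 x : (sqnorm x == 0) = (x == 0).
Proof.
apply/eqP/eqP => [|->]; last first.
  by rewrite /sqnorm big1// => i _; rewrite mxE expr0n.
move=> /eqP; rewrite /sqnorm psumr_eq0; last by move=> i _; exact: sqr_ge0.
move=> /allP H; apply/rowP => i; rewrite mxE; apply/eqP.
by rewrite -sqrf_eq0; apply: H; rewrite mem_index_enum.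
Qed.

Lemma enorm_gt0 x : x != 0 -> 0 < enorm x.
Proof. by move=> x0; rewrite sqrtr_gt0 lt_def -/(sqnorm x) sqnorm_eq0 x0 sqnorm_ge0. Qed.

Lemma enorm0 : enorm (0 : 'rV[R]_n) = 0.
Proof. by apply/eqP; rewrite -sqrf_eq0 sqr_enorm sqnorm_eq0. Qed.

Lemma sum_delta (f : 'I_n -> R) i : \sum_(k < n) (i == k)%:R * f k = f i.
Proof.
rewrite (bigD1 i)//= eqxx mul1r big1 ?addr0// => k /negPf ki.
by rewrite eq_sym ki mul0r.
Qed.

Lemma sqnorm_line x i (h : R) :
  sqnorm (h *: delta_mx 0 i + x) = sqnorm x + 2 * h * x 0 i + h ^+ 2.
Proof.
rewrite /sqnorm -addrA -(sum_delta (fun j => 2 * h * x 0 j + h ^+ 2) i) -big_split/=.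
apply: eq_bigr => k _; rewrite !mxE eqxx/= [i == k]eq_sym.
by case: (k == i) => /=; ring.
Qed.

Lemma is_derive_enorm x i : x != 0 ->
  is_derive x (delta_mx 0 i) (@enorm R n) (x 0 i / enorm x).
Proof.
move=> x0; apply/is_derive_line.
have q0 : 0 < sqnorm x + 2 * 0 * x 0 i + 0 ^+ 2.
  by rewrite mulr0 mul0r expr0n !addr0 lt_def sqnorm_eq0 x0 sqnorm_ge0.
have := @is_derive_sqrtf _ (fun h => sqnorm x + 2 * h * x 0 i + h ^+ 2) 0 _ q0
  (is_deriveDf (is_deriveDf (is_deriveCf (sqnorm x) 0)
     (is_deriveMf (is_deriveMf (is_deriveCf 2 0) (is_deriveIf 0)) (is_deriveCf (x 0 i) 0)))
     (is_deriveXf 2 (is_deriveIf 0))).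
congr (is_derive _ _ _ _).
  by apply/funext => h; rewrite /enorm -/(sqnorm _) sqnorm_line.
have -> : Num.sqrt (sqnorm x + 2 * 0 * x 0 i + 0 ^+ 2) = enorm x.
  by rewrite mulr0 mul0r (expr0n _ 2) !addr0.
by rewrite /=; field; rewrite gt_eqF// enorm_gt0.
Qed.

Lemma enorm_line0 i (h : R) : enorm (h *: delta_mx 0 i : 'rV[R]_n) = `|h|.
Proof.
rewrite /enorm -/(sqnorm _) -[_ *: _]addr0 sqnorm_line.
have -> : sqnorm (0 : 'rV[R]_n) = 0 by apply/eqP; rewrite sqnorm_eq0.
by rewrite mxE mulr0 !add0r sqrtr_sqr.
Qed.

(** With [f'] written as [t g] the partial derivative contains no division by [|x|], so the formula
    also holds at the origin and can be iterated. *)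
Lemma is_derive_radial f g x i : (forall t : R, f (- t) = f t) ->
  (forall t : R, is_derive t 1 f (t * g t)) ->
  is_derive x (delta_mx 0 i) (fun y => f (enorm y)) (x 0 i * g (enorm x)).
Proof.
move=> fe fd; have [->|x0] := eqVneq x 0.
  apply/is_derive_line; rewrite mxE mul0r.
  have := fd 0; rewrite mul0r; congr (is_derive _ _ _ _).
  apply/funext => h; rewrite addr0 enorm_line0.
  by case: (leP 0 h) => [/ger0_norm|/ltr0_norm] ->.
have /is_derive_line H := is_derive_enorm i x0.
apply/is_derive_line.
have := @is_derive_compf _ f (fun h : R => enorm (h *: delta_mx 0 i + x)) 0 _ _ _ H.
rewrite scale0r add0r => /(_ _ (fd _)); congr (is_derive _ _ _ _).
by field; rewrite gt_eqF// enorm_gt0.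
Qed.

Lemma is_derive_pderiv i F G : (forall x, is_derive x (delta_mx 0 i) F (G x)) ->
  pderiv i F = G.
Proof. by move=> Fd; apply/funext => x; have [_] := Fd x. Qed.

Lemma pderivE i F x (d : R) : is_derive x (delta_mx 0 i) F d -> pderiv i F x = d.
Proof. by case. Qed.

Lemma continuous_enorm : continuous (@enorm R n).
Proof.
have qc : continuous (fun y : 'rV[R]_n => \sum_(i < n) y 0 i ^+ 2).
  apply: continuous_big => [|i _ x]; first exact: add_continuous.
  apply: (@continuous_comp _ _ _ (fun y : 'rV[R]_n => y 0 i) (fun r : R => r ^+ 2)).
    exact: coord_continuous.
  exact: exprn_continuous.
by move=> x; apply: continuous_comp; [exact: qc|exact: sqrt_continuous].
Qed.

Lemma class_C_continuous k F : class_C k F -> continuous F.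
Proof. by case: k => [//|k []]. Qed.

Lemma class_CS k F : continuous F ->
  (forall i, exists2 G, forall x, is_derive x (delta_mx 0 i) F (G x) & class_C k G) ->
  class_C k.+1 F.
Proof.
move=> Fc FG; split => // i; have [G Fd Gk] := FG i; split.
  by move=> x; have [] := Fd x.
by rewrite (is_derive_pderiv Fd).
Qed.

Lemma class_CS_derive k F i x : class_C k.+1 F ->
  is_derive x (delta_mx 0 i) F (pderiv i F x).
Proof. by move=> [_ /(_ i)[Fd _]]; exact/derivableP. Qed.

Lemma class_CW k F : class_C k.+1 F -> class_C k F.
Proof.
elim: k F => [|k IH] F [Fc FG] //; split => // i.
by have [Fd Fk] := FG i; split => //; exact: IH.
Qed.

Lemma class_C_cst k (c : R) : class_C k (fun _ : 'rV[R]_n => c).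
Proof.
elim: k c => [|k IH] c; first exact: cst_continuous.
apply: class_CS => [|i]; first exact: cst_continuous.
exists (fun=> 0); last exact: IH.
by move=> x; exact: is_derive_vC.
Qed.

Lemma class_CD k F G : class_C k F -> class_C k G ->
  class_C k (fun x => F x + G x).
Proof.
elim: k F G => [|k IH] F G Fk Gk; have Fc := class_C_continuous Fk;
  have Gc := class_C_continuous Gk.
  by move=> x; exact: (cvgD (Fc x) (Gc x)).
apply: class_CS => [x|i]; first exact: (cvgD (Fc x) (Gc x)).
exists (fun x => pderiv i F x + pderiv i G x).
  by move=> x; apply: is_derive_vD; [exact: class_CS_derive Fk|exact: class_CS_derive Gk].
by case: Fk => _ /(_ i)[_ Fk]; case: Gk => _ /(_ i)[_ Gk]; apply: IH.
Qed.

Lemma class_CM k F G : class_C k F -> class_C k G ->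
  class_C k (fun x => F x * G x).
Proof.
elim: k F G => [|k IH] F G Fk Gk; have Fc := class_C_continuous Fk;
  have Gc := class_C_continuous Gk.
  by move=> x; exact: (cvgM (Fc x) (Gc x)).
apply: class_CS => [x|i]; first exact: (cvgM (Fc x) (Gc x)).
exists (fun x => pderiv i F x * G x + F x * pderiv i G x).
  by move=> x; apply: is_derive_vM; [exact: class_CS_derive Fk|exact: class_CS_derive Gk].
have Fk' := class_CW Fk; have Gk' := class_CW Gk.
case: Fk => _ /(_ i)[_ Fk]; case: Gk => _ /(_ i)[_ Gk].
by apply: class_CD; exact: IH.
Qed.

Lemma class_C_coord k i : class_C k (fun x : 'rV[R]_n => x 0 i).
Proof.
case: k => [|k]; first by move=> x; exact: coord_continuous.
apply: class_CS => [x|j]; first exact: coord_continuous.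
exists (fun=> (j == i)%:R); last exact: class_C_cst.
by move=> x; exact: is_derive_coord.
Qed.

Lemma class_C_radial k f : rad k f -> class_C k (fun x : 'rV[R]_n => f (enorm x)).
Proof.
elim: k f => [|k IH] f fk.
  move=> x; apply: continuous_comp; first exact: continuous_enorm.
  exact: (rad_continuous fk).
have fc := rad_continuous fk; move: fk => [fe [g fd gk]].
apply: class_CS => [x|i].
  by apply: continuous_comp; [exact: continuous_enorm|exact: fc].
exists (fun x => x 0 i * g (enorm x)); first by move=> x; exact: is_derive_radial.
by apply: class_CM; [exact: class_C_coord|exact: IH].
Qed.

Lemma class_C_ray k F i : class_C k F -> Cr k (fun t : R => F (t *: delta_mx 0 i)).
Proof.
have rc : continuous (fun t : R => t *: delta_mx 0 i : 'rV[R]_n).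
  by move=> t; apply: cvgZl; exact: cvg_id.
elim: k F => [|k IH] F Fk.
  have Fc := class_C_continuous Fk.
  by move=> t; apply: continuous_comp; [exact: rc|exact: Fc].
exists (fun t => pderiv i F (t *: delta_mx 0 i)); last first.
  by apply: IH; case: Fk => _ /(_ i)[].
move=> t; have /is_derive_line H := class_CS_derive i (t *: delta_mx 0 i) Fk.
have := @is_derive_compf _ (fun h : R => F (h *: delta_mx 0 i + t *: delta_mx 0 i)) (fun s => s - t) t (pderiv i F (t *: delta_mx 0 i)) 1.
rewrite subrr mulr1 => /(_ H) H'.
have := H' ltac:(by have := is_deriveBf (is_deriveIf t) (is_deriveCf t t); rewrite subr0).
by congr (is_derive _ _ _ _); apply/funext => s; rewrite -scalerDl subrK.
Qed.

End RadialFunctions.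

(** * Ricci curvature of rotationally symmetric metrics *)

Section RadialMetric.
Context {R : realType} {n : nat}.
Implicit Types (x y v : 'rV[R]_n) (f g : R -> R) (i j k l m : 'I_n).

Local Notation "''d_' i j" := ((i == j)%:R : R) (at level 8, i at level 2, j at level 2, format "''d_' i  j").

Definition dot x y : R := \sum_(i < n) x 0 i * y 0 i.

Lemma dot_mx x y : dot x y = (x *m y^T) 0 0.
Proof. by rewrite mxE; apply: eq_bigr => i _; rewrite mxE. Qed.

Lemma dotC x y : dot x y = dot y x.
Proof. by apply: eq_bigr => i _; rewrite mulrC. Qed.

Lemma dot_sqnorm x : dot x x = sqnorm x.
Proof. by apply: eq_bigr => i _; rewrite expr2. Qed.

Lemma dot_cauchy_schwarz x v : dot x v ^+ 2 <= sqnorm x * sqnorm v.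
Proof.
have [->|x0] := eqVneq x 0.
  have -> : dot 0 v = 0 by rewrite /dot big1// => i _; rewrite mxE mul0r.
  by rewrite expr0n mulr_ge0// sqnorm_ge0.
have r0 : 0 < sqnorm x by rewrite lt_def sqnorm_eq0 x0 sqnorm_ge0.
have : 0 <= \sum_(i < n) (sqnorm x * v 0 i - dot x v * x 0 i) ^+ 2.
  by apply: sumr_ge0 => i _; exact: sqr_ge0.
have -> : \sum_(i < n) (sqnorm x * v 0 i - dot x v * x 0 i) ^+ 2 =
    sqnorm x ^+ 2 * sqnorm v - 2 * sqnorm x * dot x v * dot x v + dot x v ^+ 2 * sqnorm x.
  rewrite (eq_bigr (fun i => sqnorm x ^+ 2 * v 0 i ^+ 2
    + - (2 * sqnorm x * dot x v) * (x 0 i * v 0 i) + dot x v ^+ 2 * x 0 i ^+ 2)); last first.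
    by move=> i _; ring.
  rewrite !big_split/= -!mulr_sumr -/(sqnorm v) -/(dot x v) -/(sqnorm x).
  by ring.
have -> : sqnorm x ^+ 2 * sqnorm v - 2 * sqnorm x * dot x v * dot x v + dot x v ^+ 2 * sqnorm x
  = sqnorm x * (sqnorm x * sqnorm v - dot x v ^+ 2) by ring.
by rewrite pmulr_rge0// subr_ge0.
Qed.

(** Since [sum x_i dx_i = t dt], the polar form is [(A + t^2 B) dt^2 + A t^2 dTheta^2]. The
    Cartesian form is smooth at the origin as soon as [A] and [B] are. *)
Definition radial_metric (A B : R -> R) : tensor2 R n := fun x =>
  \matrix_(i, j) (A (enorm x) * 'd_i j + B (enorm x) * (x 0 i * x 0 j)).

Lemma radial_metricE A B x :
  radial_metric A B x = (A (enorm x))%:M + B (enorm x) *: (x^T *m x).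
Proof.
apply/matrixP => i j; rewrite !mxE big_ord1 !mxE.
by rewrite mulr_natr.
Qed.

Lemma radial_metric_sym A B : symmetric_tensor (radial_metric A B).
Proof.
by move=> x; rewrite radial_metricE raddfD/= linearZ/= tr_scalar_mx trmx_mul trmxK.
Qed.

Lemma enorm_orthogonal (M : 'M[R]_n) x : M *m M^T = 1%:M -> enorm (x *m M) = enorm x.
Proof.
move=> MM; congr Num.sqrt; rewrite -/(sqnorm _) -/(sqnorm x) -!dot_sqnorm !dot_mx.
by rewrite trmx_mul mulmxA -(mulmxA x) MM mulmx1.
Qed.

Lemma radial_metric_rot A B : rotationally_symmetric (radial_metric A B).
Proof.
move=> M [MM _] x; rewrite /pullback !radial_metricE enorm_orthogonal//.
rewrite mulmxDr mulmxDl mul_mx_scalar -scalemxAl MM scalemx1; congr (_ + _).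
rewrite -scalemxAr -scalemxAl trmx_mul; congr (_ *: _).
by rewrite -!mulmxA MM mulmx1 mulmxA MM mul1mx.
Qed.

Lemma radial_metric_smooth A B : (forall k : nat, rad k A) -> (forall k : nat, rad k B) ->
  smooth_tensor (radial_metric A B).
Proof.
move=> Ar Br i j k; under eq_fun do rewrite mxE.
apply: class_CD; apply: class_CM; try exact: class_C_radial; first exact: class_C_cst.
by apply: class_CM; exact: class_C_coord.
Qed.

Lemma radial_metric_quadratic A B x v :
  (v *m radial_metric A B x *m v^T) 0 0 = A (enorm x) * sqnorm v + B (enorm x) * dot x v ^+ 2.
Proof.
rewrite radial_metricE mulmxDr mulmxDl mxE mul_mx_scalar -scalemxAl mxE -dot_mx dot_sqnorm.
congr (_ + _); rewrite -scalemxAr -scalemxAl mxE; congr (_ * _).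
have -> : v *m (x^T *m x) *m v^T = (v *m x^T) *m (x *m v^T) by rewrite !mulmxA.
by rewrite mxE big_ord1 -!dot_mx (dotC v) expr2.
Qed.

(** Where [B < 0], the Cauchy-Schwarz inequality bounds the form below by [(A + t^2 B) |v|^2]. *)
Lemma radial_metric_pos A B : (forall t, 0 < A t) -> (forall t, 0 < A t + t ^+ 2 * B t) ->
  forall x v, v != 0 -> 0 < (v *m radial_metric A B x *m v^T) 0 0.
Proof.
move=> A0 G0 x v v0; rewrite radial_metric_quadratic.
have v2 : 0 < sqnorm v by rewrite lt_def sqnorm_eq0 v0 sqnorm_ge0.
have [B0|B0] := leP 0 (B (enorm x)).
  by rewrite ltr_pwDl ?mulr_gt0// mulr_ge0// sqr_ge0.
have := mulr_gt0 (G0 (enorm x)) v2; rewrite sqr_enorm => H.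
apply: (lt_le_trans H); rewrite -subr_ge0.
set a := A _; set b := B _ in B0 *.
have -> : a * sqnorm v + b * dot x v ^+ 2 - (a + sqnorm x * b) * sqnorm v
  = - b * (sqnorm x * sqnorm v - dot x v ^+ 2) by ring.
by rewrite mulr_ge0 ?oppr_ge0 ?(ltW B0)// subr_ge0 dot_cauchy_schwarz.
Qed.

Lemma pos_unitmx (g : 'M[R]_n) : (forall v, v != 0 -> 0 < (v *m g *m v^T) 0 0) ->
  g \in unitmx.
Proof.
move=> gp; rewrite -row_free_unit; apply: inj_row_free => v vg.
by apply/eqP/negPn/negP => /gp; rewrite vg mul0mx mxE ltxx.
Qed.

Lemma is_derive_monomial f f1 x l i j : (forall t : R, f (- t) = f t) ->
  (forall t : R, is_derive t 1 f (t * f1 t)) ->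
  is_derive x (delta_mx 0 l) (fun y => f (enorm y) * (y 0 i * y 0 j))
   (x 0 l * f1 (enorm x) * (x 0 i * x 0 j)
    + f (enorm x) * ('d_l i * x 0 j + x 0 i * 'd_l j)).
Proof.
move=> fe fd; apply: is_derive_vM; first exact: is_derive_radial.
by apply: is_derive_vM; exact: is_derive_coord.
Qed.

Lemma is_derive_radial_coord f f1 x l i : (forall t : R, f (- t) = f t) ->
  (forall t : R, is_derive t 1 f (t * f1 t)) ->
  is_derive x (delta_mx 0 l) (fun y => f (enorm y) * y 0 i)
   (x 0 l * f1 (enorm x) * x 0 i + f (enorm x) * 'd_l i).
Proof.
move=> fe fd; apply: is_derive_vM; first exact: is_derive_radial.
exact: is_derive_coord.
Qed.

Lemma delta_refl k : 'd_k k = 1.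
Proof. by rewrite eqxx. Qed.

(* The general shape of the Christoffel symbols [Gamma^k_ij] of a rotationally
   symmetric metric. *)
Definition gam (p s w : R) x k i j : R :=
  p * (x 0 i * 'd_j k + x 0 j * 'd_i k) + s * 'd_i j * x 0 k
  + w * (x 0 i * x 0 j * x 0 k).

Lemma sum_cst (c : R) : \sum_(k < n) c = n%:R * c.
Proof. by rewrite sumr_const card_ord mulr_natl. Qed.

(** Every index contraction below is brought to this shape: in the summed index, [gam] and [dgam]
    combine Kronecker deltas and a coordinate. *)
Lemma sum_lin (a b c : R) x i k (F : 'I_n -> R) :
  \sum_(m < n) (a * 'd_k m + b * x 0 m + c * 'd_i m) * F m =
  a * F k + b * \sum_(m < n) x 0 m * F m + c * F i.
Proof.
rewrite (eq_bigr (fun m => a * ('d_k m * F m) + b * (x 0 m * F m) + c * ('d_i m * F m))).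
  by rewrite !big_split/= -!mulr_sumr !sum_delta.
by move=> m _; ring.
Qed.

Lemma sum_coord_sqr x : \sum_(m < n) x 0 m * x 0 m = sqnorm x.
Proof. exact: dot_sqnorm. Qed.

Lemma gam_coord_sum p s w x i j : \sum_(m < n) x 0 m * gam p s w x m i j =
  2 * p * x 0 i * x 0 j + sqnorm x * s * 'd_i j + sqnorm x * w * x 0 i * x 0 j.
Proof.
rewrite (eq_bigr (fun m => (p * x 0 i * 'd_j m + (s * 'd_i j + w * x 0 i * x 0 j) * x 0 m
  + p * x 0 j * 'd_i m) * x 0 m)); last by move=> m _; rewrite /gam; ring.
by rewrite sum_lin sum_coord_sqr; ring.
Qed.

Lemma gam_trace p s w x j : \sum_(k < n) gam p s w x k k j =
  ((n.+1)%:R * p + s + sqnorm x * w) * x 0 j.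
Proof.
rewrite (eq_bigr (fun k => (p * 'd_j k + (w * x 0 j) * x 0 k + s * 'd_j k) * x 0 k
  + p * x 0 j)); last first.
  by move=> k _; rewrite /gam delta_refl (eq_sym k j); ring.
rewrite big_split/= sum_lin sum_coord_sqr sumr_const card_ord -mulr_natl -natr1.
by ring.
Qed.

Lemma gam_square_sum p s w x i j :
  \sum_(k < n) \sum_(m < n) gam p s w x k i m * gam p s w x m k j =
  2 * (sqnorm x * p * s) * 'd_i j
  + (p * (n.+1%:R * p + s + sqnorm x * w) + 2 * p ^+ 2 + sqnorm x * p * w
     + w * sqnorm x * (2 * p + s + sqnorm x * w) + s * (p + s + sqnorm x * w)) * (x 0 i * x 0 j).
Proof.
pose r := sqnorm x.
pose H k := 2 * p * x 0 k * x 0 j + r * s * 'd_k j + r * w * x 0 k * x 0 j.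
have inner k : \sum_(m < n) gam p s w x k i m * gam p s w x m k j =
   p * x 0 i * gam p s w x k k j + (p * 'd_i k + (w * x 0 i) * x 0 k + 0 * 'd_i k) * H k
   + s * (x 0 k * gam p s w x i k j).
  rewrite (eq_bigr (fun m => (p * x 0 i * 'd_k m + (p * 'd_i k + w * x 0 i * x 0 k) * x 0 m
    + s * x 0 k * 'd_i m) * gam p s w x m k j)); last first.
    by move=> m _; rewrite {1}/gam (eq_sym m k); ring.
  by rewrite sum_lin gam_coord_sum /H /r; ring.
rewrite (eq_bigr _ (fun k _ => inner k)) !big_split/= -!mulr_sumr gam_trace sum_lin.
have -> : \sum_(k < n) x 0 k * gam p s w x i k j =
    p * (r * 'd_i j + x 0 i * x 0 j) + (s + r * w) * (x 0 i * x 0 j).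
  rewrite (eq_bigr (fun k => (p * x 0 j * 'd_i k + (p * 'd_i j + w * x 0 j * x 0 i) * x 0 k
    + s * x 0 i * 'd_j k) * x 0 k)); last first.
    by move=> k _; rewrite /gam (eq_sym j i) (eq_sym k i) (eq_sym k j); ring.
  by rewrite sum_lin sum_coord_sqr /r; ring.
have -> : \sum_(k < n) x 0 k * H k = ((2 * p + r * w) * r + r * s) * x 0 j.
  rewrite (eq_bigr (fun k => (r * s * 'd_j k + ((2 * p + r * w) * x 0 j) * x 0 k
    + 0 * 'd_j k) * x 0 k)); last first.
    by move=> k _; rewrite /H (eq_sym k j); ring.
  by rewrite sum_lin sum_coord_sqr /r; ring.
by rewrite /H -/r; ring.
Qed.

(* The derivative of [gam p s w x k i j] in the direction [l] when [p], [s], [w]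
   are radial functions of [x] with radial derivatives [p1], [s1], [w1]. *)
Definition dgam (p p1 s s1 w w1 : R) x l k i j : R :=
  x 0 l * p1 * (x 0 i * 'd_j k + x 0 j * 'd_i k)
  + p * ('d_l i * 'd_j k + 'd_l j * 'd_i k)
  + (x 0 l * s1 * x 0 k + s * 'd_l k) * 'd_i j
  + x 0 l * w1 * (x 0 i * x 0 j * x 0 k)
  + w * ('d_l i * x 0 j * x 0 k + x 0 i * 'd_l j * x 0 k + x 0 i * x 0 j * 'd_l k).

Lemma dgam_div p p1 s s1 w w1 x i j : \sum_(k < n) dgam p p1 s s1 w w1 x k k i j =
  (2 * p + sqnorm x * s1 + n%:R * s) * 'd_i j
  + (2 * p1 + sqnorm x * w1 + (2 + n%:R) * w) * (x 0 i * x 0 j).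
Proof.
rewrite (eq_bigr (fun k => (p1 * x 0 i * 'd_j k
    + (s1 * 'd_i j + w1 * x 0 i * x 0 j) * x 0 k + p1 * x 0 j * 'd_i k) * x 0 k
  + (w * x 0 i * 'd_j k + 0 * x 0 k + w * x 0 j * 'd_i k) * x 0 k
  + (p * 'd_i k + 0 * x 0 k + 0 * 'd_i k) * 'd_j k
  + (p * 'd_j k + 0 * x 0 k + 0 * 'd_i k) * 'd_i k
  + (s * 'd_i j + w * x 0 i * x 0 j))); last first.
  by move=> k _; rewrite /dgam delta_refl (eq_sym k i) (eq_sym k j); ring.
rewrite 4!big_split/= sum_cst.
rewrite (sum_lin _ _ (p1 * x 0 j) _ _ _ (fun k => x 0 k)) (sum_lin _ 0 (w * x 0 j) _ _ _ (fun k => x 0 k)).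
rewrite (sum_lin _ 0 0 _ _ _ (fun k => 'd_j k)) (sum_lin _ 0 0 _ _ _ (fun k => 'd_i k)).
by rewrite /= sum_coord_sqr (eq_sym j i); ring.
Qed.

Lemma dgam_trace p p1 s s1 w w1 x i j : \sum_(k < n) dgam p p1 s s1 w w1 x i k k j =
  (n.+1%:R * p + s + sqnorm x * w) * 'd_i j
  + (n.+1%:R * p1 + s1 + sqnorm x * w1 + 2 * w) * (x 0 i * x 0 j).
Proof.
rewrite (eq_bigr (fun k => (x 0 i * p1 * 'd_j k
    + (w1 * x 0 i * x 0 j + w * 'd_i j) * x 0 k + x 0 i * s1 * 'd_j k) * x 0 k
  + (w * x 0 j * 'd_i k + 0 * x 0 k + w * x 0 j * 'd_i k) * x 0 k
  + (p * 'd_i k + 0 * x 0 k + s * 'd_i k) * 'd_j k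
  + (x 0 i * p1 * x 0 j + p * 'd_i j))); last first.
  by move=> k _; rewrite /dgam delta_refl (eq_sym k j); ring.
rewrite 3!big_split/= sum_cst -natr1.
rewrite (sum_lin _ _ (x 0 i * s1) _ _ _ (fun k => x 0 k)) (sum_lin _ 0 (w * x 0 j) _ _ _ (fun k => x 0 k)).
rewrite (sum_lin _ 0 s _ _ _ (fun k => 'd_j k)).
by rewrite /= sum_coord_sqr (eq_sym j i); ring.
Qed.

(* [AP], [GS] and [GW] say that lowering the index of [gam P S W] with the metric
   gives the Christoffel symbols of the first kind. *)
Section Curvature.
Variables (A A1 B B1 P P1 S S1 W W1 : R -> R).
Hypothesis Ae : forall t : R, A (- t) = A t.
Hypothesis Be : forall t : R, B (- t) = B t.
Hypothesis Pe : forall t : R, P (- t) = P t.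
Hypothesis Se : forall t : R, S (- t) = S t.
Hypothesis We : forall t : R, W (- t) = W t.
Hypothesis Ad : forall t : R, is_derive t 1 A (t * A1 t).
Hypothesis Bd : forall t : R, is_derive t 1 B (t * B1 t).
Hypothesis Pd : forall t : R, is_derive t 1 P (t * P1 t).
Hypothesis Sd : forall t : R, is_derive t 1 S (t * S1 t).
Hypothesis Wd : forall t : R, is_derive t 1 W (t * W1 t).
Hypothesis A0 : forall t, 0 < A t.
Hypothesis G0 : forall t, 0 < A t + t ^+ 2 * B t.
Hypothesis AP : forall t, A1 t = 2 * A t * P t.
Hypothesis GS : forall t, (A t + t ^+ 2 * B t) * S t = B t - A t * P t.
Hypothesis GW : forall t, B1 t = 2 * ((A t + t ^+ 2 * B t) * W t + 2 * B t * P t).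

Let g := radial_metric A B.

Lemma pderiv_radial_metric x l i j : pderiv l (fun y => g y i j) x =
  x 0 l * A1 (enorm x) * 'd_i j + x 0 l * B1 (enorm x) * (x 0 i * x 0 j)
  + B (enorm x) * ('d_l i * x 0 j + x 0 i * 'd_l j).
Proof.
apply: pderivE; rewrite -addrA.
have := is_derive_vD (is_derive_vM (is_derive_radial x l Ae Ad) (is_derive_vC 'd_i j x _))
  (is_derive_monomial x l i j Be Bd).
rewrite mulr0 addr0; congr (is_derive _ _ _ _).
by apply/funext => y; rewrite /g mxE.
Qed.

(** The inverse metric is never computed: [low] identifies the symbols of the first kind with [g]
    applied to [gam], and [invmx g] then cancels [g]. *)
Lemma christoffel_radial x k i j : christoffel g k i j x =
  gam (P (enorm x)) (S (enorm x)) (W (enorm x)) x k i j.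
Proof.
set p := P _; set s := S _; set w := W _.
have gU : g x \in unitmx by apply: pos_unitmx; exact: radial_metric_pos.
have low l : 2^-1 * (pderiv i (fun y => g y j l) x + pderiv j (fun y => g y i l) x
     - pderiv l (fun y => g y i j) x) = \sum_(m < n) g x l m * gam p s w x m i j.
  rewrite !pderiv_radial_metric AP GW.
  have -> : \sum_(m < n) g x l m * gam p s w x m i j =
      \sum_(m < n) (A (enorm x) * 'd_l m + B (enorm x) * x 0 l * x 0 m + 0 * 'd_l m)
        * gam p s w x m i j.
    by apply: eq_bigr => m _; rewrite mxE; ring.
  rewrite sum_lin gam_coord_sum /gam -sqr_enorm -/p -/w.
  have := GS (enorm x); rewrite -/p -/s => GSx.
  set a := A _ in GSx *; set b := B _ in GSx *; set t := enorm x in GSx *.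
  have bE : b = (a + t ^+ 2 * b) * s + a * p by rewrite GSx subrK.
  rewrite (eq_sym j i) (eq_sym l i) (eq_sym l j).
  transitivity (a * p * (x 0 i * 'd_j l + x 0 j * 'd_i l)
    + ((a + t ^+ 2 * b) * w + 2 * b * p) * (x 0 i * x 0 j * x 0 l)
    + (b - a * p) * 'd_i j * x 0 l); first by field.
  by rewrite -GSx; ring.
rewrite /christoffel mulr_sumr.
rewrite (eq_bigr (fun l => invmx (g x) k l * \sum_(m < n) g x l m * gam p s w x m i j)); last first.
  by move=> l _; rewrite -low; ring.
have -> : \sum_(l < n) invmx (g x) k l * (\sum_(m < n) g x l m * gam p s w x m i j) =
   (invmx (g x) *m (g x *m (\col_m gam p s w x m i j))) k 0.
  rewrite mxE; apply: eq_bigr => l _; rewrite mxE; congr (_ * _).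
  by apply: eq_bigr => m _; congr (_ * _); rewrite mxE.
by rewrite mulKmx// mxE.
Qed.

Lemma pderiv_christoffel x l k i j : pderiv l (christoffel g k i j) x =
  dgam (P (enorm x)) (P1 (enorm x)) (S (enorm x)) (S1 (enorm x))
    (W (enorm x)) (W1 (enorm x)) x l k i j.
Proof.
have -> : christoffel g k i j = fun x =>
    gam (P (enorm x)) (S (enorm x)) (W (enorm x)) x k i j.
  by apply/funext => y; rewrite christoffel_radial.
apply: pderivE.
have Hd c m (F F1 : R -> R) : (forall t : R, F (- t) = F t) ->
  (forall t : R, is_derive t 1 F (t * F1 t)) ->
  is_derive x (delta_mx 0 l) (fun y => F (enorm y) * y 0 m * c)
    ((x 0 l * F1 (enorm x) * x 0 m + F (enorm x) * 'd_l m) * c).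
  move=> Fe Fd; have := is_derive_vM (is_derive_radial_coord x l m Fe Fd) (is_derive_vC c x _).
  by rewrite mulr0 addr0.
have := is_derive_vD (is_derive_vD (is_derive_vD (Hd 'd_j k i P P1 Pe Pd) (Hd 'd_i k j P P1 Pe Pd))
  (Hd 'd_i j k S S1 Se Sd)) (is_derive_vM (is_derive_monomial x l i j We Wd) (is_derive_coord x l k)).
congr (is_derive _ _ _ _); first by apply/funext => y; rewrite /gam; ring.
by rewrite /dgam; ring.
Qed.

Lemma ricci_radial x i j : ricci g x i j =
  let r := sqnorm x in let p := P (enorm x) in let s := S (enorm x) in
  let w := W (enorm x) in let V := n.+1%:R * p + s + r * w in
  (2 * p + r * S1 (enorm x) + n%:R * s - V + r * V * s - 2 * (r * p * s)) * 'd_i j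
  + (2 * P1 (enorm x) + (2 + n%:R) * w - (n.+1%:R * P1 (enorm x) + S1 (enorm x) + 2 * w)
     + V * (2 * p + r * w)
     - (p * V + 2 * p ^+ 2 + r * p * w + w * r * (2 * p + s + r * w) + s * (p + s + r * w)))
    * (x 0 i * x 0 j).
Proof.
cbv zeta; set r := sqnorm x; set p := P (enorm x); set s := S (enorm x).
set w := W (enorm x); pose V := n.+1%:R * p + s + r * w.
rewrite mxE /riemann.
rewrite (eq_bigr (fun k => dgam p (P1 (enorm x)) s (S1 (enorm x)) w (W1 (enorm x)) x k k i j
  - dgam p (P1 (enorm x)) s (S1 (enorm x)) w (W1 (enorm x)) x i k k j
  + (\sum_(m < n) gam p s w x k k m * gam p s w x m i j
     - \sum_(m < n) gam p s w x k i m * gam p s w x m k j))); last first.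
  move=> k _; rewrite !pderiv_christoffel -sumrB; congr (_ + _).
  by apply: eq_bigr => m _; rewrite !christoffel_radial.
rewrite big_split/= !sumrB dgam_div dgam_trace gam_square_sum exchange_big/=.
have -> : \sum_(m < n) \sum_(k < n) gam p s w x k k m * gam p s w x m i j =
    V * \sum_(m < n) x 0 m * gam p s w x m i j.
  rewrite mulr_sumr; apply: eq_bigr => m _.
  by rewrite -mulr_suml gam_trace -/r -/V mulrA.
by rewrite gam_coord_sum -/r /V -natr1; ring.
Qed.

End Curvature.
End RadialMetric.

(** * Solution of the prescribed Ricci problem *)

Section PrescribedRicci.
Context {R : realType}.
Implicit Types (f g : R -> R) (t s r : R).

Lemma rad_derivative f : (forall k, rad k f) ->
  exists2 g, forall k, rad k g & forall t, is_derive t 1 f (t * g t).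
Proof.
move=> fr; have [_ [g gd [_ gc]]] := fr 1.
by exists g => // k; exact: radD1 (fr k.+1) gd gc.
Qed.

Lemma rad_div f : (forall k, rad k f) -> f 0 = 0 ->
  exists2 g, forall k, rad k g & forall t, f t = t ^+ 2 * g t.
Proof.
move=> fr f0; have [g gr gd] := rad_derivative fr.
by exists (avg 1 g) => [k|t]; [exact: rad_avg|exact: rad_div_sqr (gr 0) f0 gd t].
Qed.

Lemma rad_integral g : (forall k, rad k g) ->
  exists2 f, forall k, rad k f & forall t, is_derive t 1 f (t * g t).
Proof.
move=> gr; have gEC := rad_even_continuous (gr 0).
have fd t := is_derive_integral t gEC.1.
exists (primitive (fun s => s * g s)) => // k; apply: radW; split.
  exact: (integral_even gEC).2.
by exists g.
Qed.

Variables (N : nat) (e : R) (S Q beta u c : R -> R).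
Hypothesis e2 : e = 1 \/ e = -1.
Hypothesis Sr : forall k, rad k S.
Hypothesis Qr : forall k, rad k Q.
Hypothesis S0 : forall t, 0 < S t.
Hypothesis ur : forall k, rad k u.
Hypothesis cr : forall k, rad k c.
Hypothesis u0 : forall t, 0 < u t.
Hypothesis c0 : c 0 = 1.
Hypothesis us0 : u 0 = S 0.
Hypothesis cd : forall t, is_derive t 1 c (t * - (e * S t * u t)).
Hypothesis uQ : forall t, t ^+ 2 * u t ^+ 2 = t ^+ 2 * Q t - e * N%:R * (1 - c t ^+ 2).

(* In polar form the metric is [A (lam^2 dt^2 + t^2 dTheta^2)] with [lam = S / u]. *)
Theorem metric_of_profile : exists A B : R -> R,
  [/\ forall k, rad k A, forall k, rad k B, forall t, 0 < A t,
     forall t, 0 < A t + t ^+ 2 * B t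
   & forall (x : 'rV[R]_N.+2) i j,
     exists2 Z, ricci (radial_metric A B) x i j
        = e * Q (enorm x) * (i == j)%:R + Z * (x 0 i * x 0 j)
     & sqnorm x * Z = e * N.+1%:R * S (enorm x) ^+ 2 - e * Q (enorm x) \/ x = 0].
Proof.
have un t : u t != 0 by rewrite gt_eqF.
pose lam t := S t / u t.
have lam_r k : rad k lam by apply: radM => //; exact: radV.
have lam0 t : 0 < lam t by rewrite divr_gt0.
have lamn t : lam t != 0 by rewrite gt_eqF.
have lam00 : lam 0 = 1 by rewrite /lam us0 divff// gt_eqF.
(* With [a = exp f lam] and [b = t exp f], the relation [c = b'/a] reads [1 + t f' = c lam], so [P]
   is [f'/t]. Its numerator vanishes at 0 because [c 0 = lam 0 = 1]. *)
have [P Pr PE] : exists2 P, forall k, rad k P & forall t, c t * lam t - 1 = t ^+ 2 * P t.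
  apply: (@rad_div (fun t => c t * lam t - 1)) => [k|].
    by apply: radB; [exact: radM|exact: rad_cst].
  by rewrite c0 lam00 mulr1 subrr.
(* The value that [GS] forces: [lam^2 t^2 s = (lam^2 - 1) - (c lam - 1)]. *)
have [s sr sE] : exists2 s, forall k, rad k s & forall t, 1 - c t / lam t = t ^+ 2 * s t.
  apply: (@rad_div (fun t => 1 - c t / lam t)) => [k|].
    by apply: radB; [exact: rad_cst|apply: radM => //; exact: radV].
  by rewrite c0 lam00 divr1 subrr.
have [b br bE] : exists2 b, forall k, rad k b & forall t, lam t ^+ 2 - 1 = t ^+ 2 * b t.
  apply: (@rad_div (fun t => lam t ^+ 2 - 1)) => [k|].
    by apply: radB; [exact: radX|exact: rad_cst].
  by rewrite lam00 expr1n subrr.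
have [f fr fd] := rad_integral Pr.
pose A t := expR (f t) ^+ 2.
pose B t := A t * b t.
have Ar k : rad k A by apply: radX; exact: rad_exp.
have Br k : rad k B by exact: radM.
have A0 t : 0 < A t by rewrite exprn_gt0// expR_gt0.
have GE t : A t + t ^+ 2 * B t = A t * lam t ^+ 2.
  by rewrite /B mulrCA -bE; ring.
have G0 t : 0 < A t + t ^+ 2 * B t by rewrite GE mulr_gt0// exprn_gt0.
have [lam1 lam1r lamd] := rad_derivative lam_r.
have [P1 P1r Pd] := rad_derivative Pr.
have [s1 s1r sd] := rad_derivative sr.
have [b1 b1r bd] := rad_derivative br.
pose A1 t := 2 * A t * P t.
have Ad t : is_derive t 1 A (t * A1 t).
  have := is_deriveXf 2 (is_derive_compf (is_derive_expR (f t)) (fd t)).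
  by congr (is_derive t 1 _ _); rewrite /A1 /A /=; ring.
pose B1 t := A1 t * b t + A t * b1 t.
have B1r k : rad k B1.
  apply: radD; last exact: radM.
  by apply: radM => //; apply: radM => //; apply: radM => //; exact: rad_cst.
have Bd t : is_derive t 1 B (t * B1 t).
  have := is_deriveMf (Ad t) (bd t).
  by congr (is_derive t 1 _ _); rewrite /B1; ring.
(* Obtained by solving [GW] for [W]; the denominator is [A + t^2 B]. *)
pose W t := (2^-1 * B1 t - 2 * B t * P t) * (A t * lam t ^+ 2)^-1.
have GWn t : A t * lam t ^+ 2 != 0 by rewrite gt_eqF// mulr_gt0// exprn_gt0.
have Wr k : rad k W.
  apply: radM; last by apply: radV => //; apply: radM => //; exact: radX.
  by apply: radB; [|apply: radM => //]; apply: radM => //; exact: rad_cst.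
have [W1 W1r Wd] := rad_derivative Wr.
have GS t : (A t + t ^+ 2 * B t) * s t = B t - A t * P t.
  suff : (fun t => (A t + t ^+ 2 * B t) * s t) = (fun t => B t - A t * P t).
    by move=> /(congr1 (@^~ t)).
  apply: punctured_eq.
  - apply: (rad_continuous (k := 0)); apply: radM => //; apply: radD => //.
    by apply: radM => //; exact: rad_sqr.
  - by apply: (rad_continuous (k := 0)); apply: radB => //; exact: radM.
  - move=> r r0; apply: (@mulfI _ (r ^+ 2)); first by rewrite expf_neq0.
    rewrite GE mulrCA -sE.
    have -> : r ^+ 2 * (B r - A r * P r) = A r * (r ^+ 2 * b r - r ^+ 2 * P r).
      by rewrite /B; ring.
    by rewrite -bE -PE; field.
have GW t : B1 t = 2 * ((A t + t ^+ 2 * B t) * W t + 2 * B t * P t).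
  by rewrite GE /W mulrC [_ * (_ * _^-1)]mulrC divfK//; field.
have cE t : t != 0 -> P t = (c t * lam t - 1) / t ^+ 2.
  by move=> t0; rewrite PE mulrC mulKf// expf_neq0.
have sEE t : t != 0 -> s t = (1 - c t / lam t) / t ^+ 2.
  by move=> t0; rewrite sE mulrC mulKf// expf_neq0.
(* Differentiating the identity that defines [P] and inserting the equation for [c'] expresses [P1]
   through [c], [lam], [lam1] and [u]. The same is done for [s1], and then [W] is rewritten, so that
   the curvature identities become field identities. *)
have P1E t : t != 0 -> P1 t = (- (e * lam t * u t ^+ 2) * lam t + c t * lam1 t - 2 * P t) / t ^+ 2.
  move=> t0; have H1 := is_deriveBf (is_deriveMf (cd t) (lamd t)) (is_deriveCf 1 t).
  have H2 := is_deriveMf (is_deriveXf 2 (is_deriveIf t)) (Pd t).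
  have EE : (fun t => c t * lam t - 1) = (fun t => t ^+ 2 * P t) by apply/funext.
  rewrite EE in H1; have := is_derive_unique H1 H2.
  have -> : S t = lam t * u t by rewrite /lam divfK.
  rewrite /= => H; apply: (@mulIf _ (t ^+ 2)); first by rewrite expf_neq0.
  rewrite divfK ?expf_neq0//; apply: (mulfI t0).
  by move: H; lra.
have s1E t : t != 0 -> s1 t = (e * u t ^+ 2 + c t * lam1 t / lam t ^+ 2 - 2 * s t) / t ^+ 2.
  move=> t0; have H1 := is_deriveBf (is_deriveCf 1 t) (is_deriveMf (cd t) (is_deriveVf (lamn t) (lamd t))).
  have H2 := is_deriveMf (is_deriveXf 2 (is_deriveIf t)) (sd t).
  have EE : (fun t => 1 - c t / lam t) = (fun t => t ^+ 2 * s t) by apply/funext.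
  rewrite EE in H1; have := is_derive_unique H1 H2.
  have -> : S t = lam t * u t by rewrite /lam divfK.
  rewrite /= => H; apply: (@mulIf _ (t ^+ 2)); first by rewrite expf_neq0.
  rewrite divfK ?expf_neq0//; apply: (mulfI t0).
  have H3 : t * - (e * (lam t * u t) * u t) / lam t = - (t * e * u t ^+ 2).
    by field.
  by move: H; rewrite H3 mulNr !mulrN; lra.
have WE t : t != 0 -> W t = (lam1 t / lam t - P t - s t) / t ^+ 2.
  move=> t0; have H1 := is_deriveBf (is_deriveXf 2 (lamd t)) (is_deriveCf 1 t).
  have H2 := is_deriveMf (is_deriveXf 2 (is_deriveIf t)) (bd t).
  have EE : (fun t => lam t ^+ 2 - 1) = (fun t => t ^+ 2 * b t) by apply/funext.
  rewrite EE in H1; have H := is_derive_unique H1 H2.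
  have t2 : t ^+ 2 != 0 by rewrite expf_neq0.
  have bEE : b t = (lam t ^+ 2 - 1) / t ^+ 2 by rewrite bE mulrC mulKf.
  have b1E : b1 t = (2 * lam t * lam1 t - 2 * b t) / t ^+ 2.
    apply: (mulIf t2); rewrite divfK//; apply: (mulfI t0).
    by move: H => /=; lra.
  rewrite /W /B1 /B /A1 b1E bEE (sEE t t0) (cE t t0).
  have An : A t != 0 by rewrite gt_eqF.
  by field; rewrite t0 lamn An.
exists A, B; split => // x i j.
have H := ricci_radial (fun t => rad_even t (Ar 0)) (fun t => rad_even t (Br 0))
  (fun t => rad_even t (Pr 0)) (fun t => rad_even t (sr 0)) (fun t => rad_even t (Wr 0))
  Ad Bd Pd sd Wd A0 G0 (fun t => erefl) GS GW x i j.
pose V t := N.+3%:R * P t + s t + t ^+ 2 * W t.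
pose U t := 2 * P t + t ^+ 2 * s1 t + N.+2%:R * s t - V t + t ^+ 2 * V t * s t
  - 2 * (t ^+ 2 * P t * s t).
pose Z t := 2 * P1 t + (2 + N.+2%:R) * W t - (N.+3%:R * P1 t + s1 t + 2 * W t)
  + V t * (2 * P t + t ^+ 2 * W t)
  - (P t * V t + 2 * P t ^+ 2 + t ^+ 2 * P t * W t
     + W t * t ^+ 2 * (2 * P t + s t + t ^+ 2 * W t) + s t * (P t + s t + t ^+ 2 * W t)).
have {}H : ricci (radial_metric A B) x i j =
    U (enorm x) * (i == j)%:R + Z (enorm x) * (x 0 i * x 0 j).
  by rewrite H /U /Z /V -sqr_enorm.
have ee : e * e = 1 by case: e2 => ->; rewrite ?mulr1 ?mulrNN ?mulr1.
(* The angular component. This is where the first integral [uQ] enters; the identity is proved off 0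
   and extended by continuity. *)
have UQ : U = fun t => e * Q t.
  have rc (k : nat) (r : R) : rad k (fun=> r) by exact: rad_cst.
  have r2 (k : nat) : rad k (fun t => t ^+ 2) by exact: rad_sqr.
  have Vr : rad 0 V := radD (radD (radM (rc 0 _) (Pr 0)) (sr 0)) (radM (r2 0) (Wr 0)).
  have Ur : rad 0 U := radB (radD (radB (radD (radD (radM (rc 0 2) (Pr 0))
      (radM (r2 0) (s1r 0))) (radM (rc 0 N.+2%:R) (sr 0))) Vr)
    (radM (radM (r2 0) Vr) (sr 0))) (radM (rc 0 2) (radM (radM (r2 0) (Pr 0)) (sr 0))).
  apply: punctured_eq.
  - exact: (rad_continuous Ur).
  - exact: (rad_continuous (radM (rc 0 e) (Qr 0))).
  - move=> t t0; rewrite /U /V (s1E t t0) (WE t t0) (sEE t t0) (cE t t0).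
    have -> : Q t = u t ^+ 2 + e * N%:R * (1 - c t ^+ 2) / t ^+ 2.
      have t2 : t ^+ 2 != 0 by rewrite expf_neq0.
      by apply: (mulfI t2); rewrite mulrDr uQ mulrCA divff// mulr1; ring.
    have -> : e * (u t ^+ 2 + e * N%:R * (1 - c t ^+ 2) / t ^+ 2) =
        e * u t ^+ 2 + (e * e) * N%:R * (1 - c t ^+ 2) / t ^+ 2 by ring.
    by rewrite ee -!natr1; field; rewrite t0 lamn.
(* The radial component [U + t^2 Z] equals [e (n-1) S^2]; this is the equation for [c']. *)
have ZE t : t != 0 -> t ^+ 2 * Z t = e * N.+1%:R * S t ^+ 2 - U t.
  move=> t0; rewrite /U /Z /V (P1E t t0) (s1E t t0) (WE t t0) (sEE t t0) (cE t t0).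
  have -> : S t = lam t * u t by rewrite /lam divfK.
  by rewrite -!natr1; field; rewrite t0 lamn.
exists (Z (enorm x)); first by rewrite H UQ.
have [->|x0] := eqVneq x 0; first by right.
by left; rewrite -sqr_enorm ZE ?gt_eqF ?enorm_gt0// UQ.
Qed.

End PrescribedRicci.

(** * Components of the prescribed tensor *)

Section SmoothRadialTensor.
Context {R : realType}.

Lemma constant_sign (f : R -> R) : continuous f -> (forall t, f t != 0) ->
  0 < f 0 -> forall t, 0 < f t.
Proof.
move=> fc fn f0 t; rewrite ltNge; apply/negP => ft.
have [c _ fc0] : exists2 c, true & f c = 0.
  have [t0|t0] := leP 0 t.
    have [|c _ fc0] := IVT (v := 0) t0 (continuous_subspaceT fc).
      by rewrite ge_min le_max ft (ltW f0) orbT.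
    by exists c.
  have [|c _ fc0] := IVT (v := 0) (ltW t0) (continuous_subspaceT fc).
    by rewrite ge_min le_max ft (ltW f0) orbT.
  by exists c.
by have := fn c; rewrite fc0 eqxx.
Qed.

Variables (N : nat) (T : tensor2 R N.+2) (phi psi : R -> R).
Hypothesis T_smooth : smooth_tensor T.
Hypothesis T_form : forall x : 'rV[R]_N.+2, x != 0 ->
     T x = phi (enorm x) *: dt2 x
           + (enorm x ^+ 2 * psi (enorm x)) *: dTheta2 x.

Lemma dt2E (x : 'rV[R]_N.+2) i j : x != 0 ->
  dt2 x i j = x 0 i * x 0 j / enorm x ^+ 2.
Proof.
move=> x0; rewrite mxE !(pderivE (is_derive_enorm _ x0)).
by field; rewrite gt_eqF// enorm_gt0.
Qed.

Lemma dTheta2E (x : 'rV[R]_N.+2) i j : x != 0 ->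
  dTheta2 x i j = ((i == j)%:R - x 0 i * x 0 j / enorm x ^+ 2) / enorm x ^+ 2.
Proof.
move=> x0; have tn : enorm x != 0 by rewrite gt_eqF// enorm_gt0.
pose t := enorm x.
have pd l k : pderiv l (sphere_proj k) x = t^-1 * (l == k)%:R + - x 0 l / t ^+ 3 * x 0 k.
  apply: pderivE.
  have := is_derive_vM (is_derive_coord x l k) (is_derive_vV tn (is_derive_enorm l x0)).
  by congr (is_derive _ _ _ _); rewrite /t; field.
rewrite mxE.
rewrite (eq_bigr (fun k => (t^-1 * (i == k)%:R + - x 0 i / t ^+ 3 * x 0 k + 0 * (i == k)%:R)
  * (t^-1 * (j == k)%:R + - x 0 j / t ^+ 3 * x 0 k + 0 * (j == k)%:R))); last first.
  by move=> k _; rewrite !pd; ring.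
rewrite sum_lin.
(* The derivatives of the projection to the sphere are orthogonal to [x]. *)
have -> : \sum_(m < N.+2) x 0 m * (t^-1 * (j == m)%:R + - x 0 j / t ^+ 3 * x 0 m + 0 * (j == m)%:R)
   = 0.
  rewrite (eq_bigr (fun m => (t^-1 * (j == m)%:R + - x 0 j / t ^+ 3 * x 0 m + 0 * (j == m)%:R) * x 0 m)).
    by rewrite sum_lin sum_coord_sqr -sqr_enorm /t; field.
  by move=> m _; rewrite mulrC.
by rewrite (eq_sym j i) /t; field.
Qed.

Lemma tensorE (x : 'rV[R]_N.+2) i j : x != 0 ->
  T x i j = psi (enorm x) * (i == j)%:R
    + (phi (enorm x) - psi (enorm x)) / enorm x ^+ 2 * (x 0 i * x 0 j).
Proof.
move=> x0; rewrite T_form// mxE [X in X + _]mxE [X in _ + X]mxE dt2E// dTheta2E//.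
by field; rewrite gt_eqF// enorm_gt0.
Qed.

Let i0 : 'I_N.+2 := ord0.
Let i1 : 'I_N.+2 := lift ord0 ord0.
Let ray (t : R) : 'rV[R]_N.+2 := t *: delta_mx 0 i0.

Let ray_coord t i : ray t 0 i = t * (i0 == i)%:R.
Proof. by rewrite !mxE eqxx eq_sym. Qed.

Let enorm_ray t : enorm (ray t) = `|t|.
Proof. exact: enorm_line0. Qed.

Let ray_neq0 t : t != 0 -> ray t != 0.
Proof.
by move=> t0; apply: contra_neq t0 => /(congr1 (@enorm R _)); rewrite enorm_ray enorm0 => /normr0_eq0.
Qed.

(** On the axis the diagonal entries depend on [phi] and [psi] at [|t|] and on squares of the
    coordinates, so they are even; smoothness of [T] then gives smoothness in [t^2]. *)
Lemma tensor_ray_rad i k : rad k (fun t => T (ray t) i i).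
Proof.
apply: even_Cr_rad; last exact: (class_C_ray i0 (T_smooth i i k.*2)).
move=> t; have [->|t0] := eqVneq t 0; first by rewrite oppr0.
rewrite !tensorE ?ray_neq0 ?oppr_eq0// !enorm_ray normrN !ray_coord.
by congr (_ + _ * _); ring.
Qed.

Definition radial_part t := T (ray t) i0 i0.
Definition angular_part t := T (ray t) i1 i1.

Lemma radial_partE t : t != 0 -> radial_part t = phi `|t|.
Proof.
move=> t0; have tn : `|t| != 0 by rewrite normr_eq0.
rewrite /radial_part tensorE ?ray_neq0// enorm_ray ray_coord eqxx real_normK ?num_real//.
by rewrite /=; field.
Qed.

Lemma angular_partE t : t != 0 -> angular_part t = psi `|t|.
Proof.
move=> t0; rewrite /angular_part tensorE ?ray_neq0// enorm_ray ray_coord eqxx.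
by rewrite /=; ring.
Qed.

Let tensor_ray_continuous i j : continuous (fun t => T (ray t) i j).
Proof. exact: (class_C_ray i0 (T_smooth i j 0)). Qed.

(** The same entry of [T 0] is approached along two axes: it is radial along the first and angular
    along the second. *)
Lemma parts_eq0 : radial_part 0 = angular_part 0.
Proof.
pose ray1 (t : R) : 'rV[R]_N.+2 := t *: delta_mx 0 i1.
have c1 : continuous (fun t => T (ray1 t) i0 i0) := class_C_ray i1 (T_smooth i0 i0 0).
have E : (fun t => T (ray1 t) i0 i0) = angular_part.
  apply: punctured_eq => //; first exact: tensor_ray_continuous.
  move=> t t0; rewrite angular_partE// tensorE; last first.
    by apply: contra_neq t0 => /(congr1 (@enorm R _)); rewrite enorm_line0 enorm0 => /normr0_eq0.
  rewrite enorm_line0 (_ : ray1 t 0 i0 = 0); last by rewrite !mxE mulr0.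
  by rewrite eqxx /=; ring.
have := congr1 (@^~ 0) E; rewrite /= /ray1 scale0r => <-.
by rewrite /radial_part /ray scale0r.
Qed.

(** [T_form] says nothing at the origin; the value there is the limit along a ray, where the radial
    and angular parts coincide. *)
Lemma tensor0E i j : T 0 i j = angular_part 0 * (i == j)%:R.
Proof.
have E : (fun t => T (ray t) i j) = fun t => angular_part t * (i == j)%:R
    + (radial_part t - angular_part t) * ((i0 == i)%:R * (i0 == j)%:R).
  apply: punctured_eq; first exact: tensor_ray_continuous.
    apply: continuousDf; apply: continuousMf; try exact: continuousCf.
      exact: tensor_ray_continuous.
    by apply: continuousDf; [|apply: continuousNf]; exact: tensor_ray_continuous.
  move=> t t0; have tn : `|t| != 0 by rewrite normr_eq0.
  rewrite radial_partE// angular_partE// tensorE ?ray_neq0// enorm_ray !ray_coord.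
  by rewrite real_normK ?num_real//; field.
have := congr1 (@^~ 0) E; rewrite /= parts_eq0 subrr mul0r addr0.
by rewrite /ray scale0r.
Qed.

Lemma angular_part0_neq0 : nonsingular T -> angular_part 0 != 0.
Proof.
move=> /(_ 0); apply: contraTneq => a0.
have -> : T 0 = 0 by apply/matrixP => i j; rewrite tensor0E a0 mul0r mxE.
by rewrite unitmxE det0 unitr0.
Qed.

(** Puts [T] in the shape in which [metric_of_profile] delivers the Ricci tensor, the origin
    included. *)
Lemma tensor_partsE (x : 'rV[R]_N.+2) i j : exists2 Z,
  T x i j = angular_part (enorm x) * (i == j)%:R + Z * (x 0 i * x 0 j)
  & sqnorm x * Z = radial_part (enorm x) - angular_part (enorm x).
Proof.
have [->|x0] := eqVneq x 0.
  exists 0; rewrite ?enorm0; first by rewrite tensor0E mul0r addr0.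
  by rewrite mulr0 parts_eq0 subrr.
have tn : enorm x != 0 by rewrite gt_eqF// enorm_gt0.
rewrite radial_partE// angular_partE// (ger0_norm (enorm_ge0 x)).
eexists; first exact: tensorE.
by rewrite -sqr_enorm mulrC divfK// expf_neq0.
Qed.

End SmoothRadialTensor.

Theorem theorem1 (R : realType) (n : nat) (hn : (2 <= n)%N)
  (T : tensor2 R n) (phi psi : R -> R)
  (phi_smooth : smooth1 phi) (psi_smooth : smooth1 psi)
  (T_smooth : smooth_tensor T) (T_sym : symmetric_tensor T)
  (T_nonsingular : nonsingular T) (T_rot : rotationally_symmetric T)
  (T_form : forall x : 'rV[R]_n, x != 0 ->
     T x = phi (enorm x) *: dt2 x
           + (enorm x ^+ 2 * psi (enorm x)) *: dTheta2 x)
  (F_regular : forall t w p : R, 0 <= t -> calF n phi psi (t, w, p) = 0 ->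
     ~ ('d (calF n phi psi) (t, w, p) =1 fun=> 0))
  (Sigma_regular : forall t : R, 0 < t ->
     phi t * (fun s : R => s ^+ 2 * psi s)^`()%classic t != 0) :
  exists g : tensor2 R n,
    [/\ riemannian_metric g, rotationally_symmetric g
      & forall x : 'rV[R]_n, ricci g x = T x].
Proof.
clear F_regular phi_smooth psi_smooth T_sym T_rot.
case: n hn T T_smooth T_nonsingular T_form => [//|[//|N]] _ T T_smooth T_nonsingular T_form.
pose p : R -> R := radial_part T; pose q : R -> R := angular_part T.
have pr k : rad k p by exact: tensor_ray_rad T_smooth T_form _ k.
have qr k : rad k q by exact: tensor_ray_rad T_smooth T_form _ k.
have pq0 : p 0 = q 0 := parts_eq0 T_smooth T_form.
have q0 : q 0 != 0 := angular_part0_neq0 T_smooth T_form T_nonsingular.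
(* Away from 0 this is the factor [phi] in [Sigma_regular]; at 0 it is nonsingularity of [T]. *)
have pn t : p t != 0.
  have [->|t0] := eqVneq t 0; first by rewrite pq0.
  rewrite /p (radial_partE T_form)//; have tp : 0 < `|t| by rewrite normr_gt0.
  by have := Sigma_regular _ tp; rewrite mulf_eq0 negb_or => /andP[].
pose e : R := if 0 < p 0 then 1 else -1.
have e2 : e = 1 \/ e = -1 by rewrite /e; case: ifP; [left|right].
have ee : e * e = 1 by case: e2 => ->; rewrite ?mulr1 ?mulrNN ?mulr1.
have en : e != 0 by case: e2 => ->; rewrite ?oppr_eq0 oner_eq0.
have er k : rad k (fun=> e) by exact: rad_cst.
have ep0 : 0 < e * p 0.
  rewrite /e; have [H|H] := ltP 0 (p 0); first by rewrite mul1r.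
  by rewrite mulN1r oppr_gt0 lt_def eq_sym pn.
have ep : forall t, 0 < e * p t.
  apply: constant_sign => //; last by move=> t; rewrite mulf_neq0.
  exact: rad_continuous (radM (er 0) (pr 0)).
have [q1 q1r qd] := rad_derivative qr.
(* [(t^2 e q)' / (2 t)] written without division, using [q' = t q1]. *)
pose beta t := e * q t + (e * 2^-1) * (t ^+ 2 * q1 t).
have br k : rad k beta.
  apply: radD; first exact: radM.
  apply: radM; first exact: rad_cst.
  by apply: radM => //; exact: rad_sqr.
have t2q (t : R) : is_derive t 1 (fun t : R => t ^+ 2 * q t) (2 * (t * (q t + 2^-1 * (t ^+ 2 * q1 t)))).
  have := is_deriveMf (is_deriveXf 2 (is_deriveIf t)) (qd t).
  by congr (is_derive t 1 _ _); rewrite /=; field.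
have bE t : beta t = e * (q t + 2^-1 * (t ^+ 2 * q1 t)) by rewrite /beta; ring.
have b00 : beta 0 = e * p 0 by rewrite bE (expr0n _ 2) mul0r mulr0 addr0 pq0.
(* For [t > 0] this is the other factor in [Sigma_regular], negative [t] follow by evenness, and at
   0 the value is [e p 0]. *)
have bn t : beta t != 0.
  wlog t0 : t / 0 <= t.
    move=> H; have [/H//|/ltW t0] := leP 0 t.
    by rewrite -(rad_even _ (br 0)) H// oppr_ge0.
  move: t0; rewrite le_eqVlt => /predU1P[<-|t0]; first by rewrite b00 gt_eqF.
  rewrite bE mulf_neq0//; have := Sigma_regular _ t0.
  have near_q : \forall s \near t, s ^+ 2 * q s = s ^+ 2 * psi s.
    have : \forall s \near t, 0 < s by exact: lt_nbhsr.
    apply: filterS => s s0; rewrite /q (angular_partE T_form) ?gt_eqF//.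
    by rewrite gtr0_norm.
  have [_ psid] := is_derive_near near_q (t2q t).
  rewrite derive1E psid.
  by rewrite !mulf_eq0 !negb_or => /andP[_ /andP[_ /andP[]]].
have b0 : forall t, 0 < beta t.
  apply: constant_sign => //; last by rewrite b00.
  exact: rad_continuous (br 0).
pose S t := Num.sqrt (e * p t / N.+1%:R).
have a0 t : 0 < e * p t / N.+1%:R by rewrite divr_gt0// ltr0n.
have Sr k : rad k S.
  apply: rad_sqrt => //; apply: radM; last exact: rad_cst.
  exact: radM.
have S0 t : 0 < S t by rewrite sqrtr_gt0.
have S2 t : N.+1%:R * S t ^+ 2 = e * p t.
  by rewrite /S sqr_sqrtr ?ltW// mulrC divfK// pnatr_eq0.
pose Q t := e * q t.
have Qr k : rad k Q by exact: radM.
have Qd (t : R) : is_derive t 1 (fun t : R => t ^+ 2 * Q t) (2 * (t * beta t)).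
  have := is_deriveMf (is_deriveCf e t) (t2q t).
  congr (is_derive t 1 _ _); last by rewrite bE; ring.
  by apply/funext => s; rewrite /Q mulrCA.
have bS : beta 0 = N.+1%:R * S 0 ^+ 2 by rewrite S2 b00.
have [u [c [[ur cr u0 [c0 us0]] [cd _ uQ]]]] := profile_exists (N := N) e2 Sr Qr br S0 b0 Qd bS.
have [A [B [Ar Br A0 G0 ric]]] := metric_of_profile (N := N) e2 Sr Qr S0 ur cr u0 c0 us0 cd uQ.
exists (radial_metric A B); split.
- split; [exact: radial_metric_smooth|exact: radial_metric_sym|exact: radial_metric_pos].
- exact: radial_metric_rot.
- move=> x; apply/matrixP => i j; have [Z -> ZE] := ric x i j.
  have [Z' -> Z'E] := tensor_partsE T_smooth T_form x i j.
  rewrite /Q mulrA ee mul1r; congr (_ + _).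
  (* The coefficients of [x_i x_j] are determined only off the origin, where both equal the radial
     minus the angular part divided by [|x|^2]; at the origin their factor is 0. *)
  have [->|x0] := eqVneq x 0; first by rewrite mxE !mul0r !mulr0.
  congr (_ * _); case: ZE => [ZE|/eqP]; last by rewrite (negPf x0).
  have rn : sqnorm x != 0 by rewrite sqnorm_eq0.
  by apply: (mulfI rn); rewrite ZE Z'E /Q -mulrA S2 !mulrA ee !mul1r.
Qed.
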